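(* Let $\mathbf{K}$ be $\mathbf{R}$ or $\mathbf{C}$. For every $n$, let $E_n,F_n\in\mathsf{G}_{2n,n}$ be independent Haar-distributed random subspaces of dimension $n$ in $\mathbf{K}^{2n}$, and let $(\theta_i^n)_{1\leq i\leq n}$ be the principal angles of the pair $(E_n,F_n)$. As $n\to\infty$, the empirical distribution $\frac1n\sum_{i=1}^n\delta_{\theta_i^n}$ converges weakly in probability towards the uniform distribution on $[0,\pi/2]$.
   Context: $\mathbf{K}^n$ carries its usual inner product. $\mathsf{G}_{n,k}$ is the Grassmann manifold of all $k$-dimensional subspaces of $\mathbf{K}^n$; its Haar measure is the unique rotation-invariant probability measure on it (equivalently, the law of the span of $k$ independent standard Gaussian vectors in $\mathbf{K}^n$). Principal angles: for $E\in\mathsf{G}_{n,k}$ and $F\in\mathsf{G}_{n,l}$ there exist an orthonormal basis $(e_i)_{1\leq i\leq k}$ of $E$, an orthonormal basis $(f_j)_{1\leq j\leq l}$ of $F$, and numbers $\theta_1\leq\dots\leq\theta_{\min(k,l)}$ in $[0,\pi/2]$ such that $\langle e_i,f_j\rangle=0$ for $i\neq j$ and $\langle e_i,f_i\rangle=\cos\theta_i$. The numbers $\theta_i$ are uniquely determined by $E,F$ and are called the principal angles between $E$ and $F$ (counted with multiplicity). Convergence of a sequence of random measures means weak convergence in probability. $\delta_x$ is the Dirac mass at $x$. *)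

(* Defs.v *)
From HB Require Import structures.
From mathcomp Require Import all_boot all_order all_algebra.
From mathcomp Require Import complex.
From mathcomp Require Import all_classical all_reals all_analysis.

Set Implicit Arguments.
Unset Strict Implicit.
Unset Printing Implicit Defensive.

Import Order.TTheory GRing.Theory Num.Theory.
Import numFieldNormedType.Exports.

Local Open Scope classical_set_scope.
Local Open Scope ring_scope.

(* A scalar field together with its conjugation and the embedding of the reals.
   No axiom ties the components together: only the two instances below are
   ever used. *)
Record scalarField (R : realType) := ScalarField {
  scalar :> numFieldType ;
  sconj : {rmorphism scalar -> scalar} ;
  sreal : {rmorphism R -> scalar} }.

Definition realScalars (R : realType) : scalarField R :=
  @ScalarField R R idfun idfun.

Definition complexScalars (R : realType) : scalarField R :=
  @ScalarField R R[i] (@conjc R) (real_complex R).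

Section InnerProduct.
Context {R : realType} {K : scalarField R} {m : nat}.

Definition inner (u v : 'rV[K]_m) : K := \sum_i u ord0 i * sconj K (v ord0 i).

Definition orthonormal_basis (E : {vspace 'rV[K]_m}) k
    (e : k.-tuple 'rV[K]_m) : Prop :=
  basis_of E e /\ forall i j, inner (tnth e i) (tnth e j) = (i == j)%:R.

(* Matrices act on row vectors from the right. *)
Definition is_isometry (U : 'M[K]_m) : Prop :=
  U *m (map_mx (sconj K) U)^T = 1%:M.

Definition is_principal_angles (E F : {vspace 'rV[K]_m}) (theta : seq R) :
    Prop :=
  [/\ size theta = minn (\dim E) (\dim F),
      sorted <=%R theta,
      {in theta, forall t, 0 <= t <= pi / 2} &
      exists (e : (\dim E).-tuple 'rV[K]_m) (f : (\dim F).-tuple 'rV[K]_m),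
        [/\ orthonormal_basis E e, orthonormal_basis F f &
            forall i j, inner (tnth e i) (tnth f j) =
              if i == j :> nat then sreal K (cos theta`_i) else 0]].

End InnerProduct.

(* The proof [km] only serves to make the type inhabited, as required of a
   measurable space. *)
Record grassmann (R : realType) (K : scalarField R) (m k : nat)
    (km : (k <= m)%N) := Grassmann {
  gval :> {vspace 'rV[K]_m} ;
  _ : \dim gval == k }.

Section Grassmann.
Context {R : realType} (K : scalarField R) (m k : nat) (km : (k <= m)%N).
Local Notation G := (grassmann K km).

HB.instance Definition _ := [isSub of G for @gval R K m k km].
HB.instance Definition _ := [Choice of G by <:].

Let dim_point : \dim <<take k (vbasis {:'rV[K]_m})>>%VS == k.
Proof.
have /(basis_free) := vbasisP {:'rV[K]_m}.
rewrite -{1}(cat_take_drop k (vbasis _)) => /catl_free.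
rewrite /free => /eqP ->; rewrite size_takel // size_tuple dimvf /dim /=.
by rewrite mul1n.
Qed.

HB.instance Definition _ := isPointed.Build G (Grassmann km dim_point).

(* The usual topology of the Grassmann manifold, i.e. the quotient topology
   for the map sending a k x m matrix of rank k (such matrices form an open
   set) to the span of its rows. *)
Definition grassmann_open : set (set G) :=
  [set U | open [set A : 'M[K]_(k, m) |
    exists2 E : G, U E & basis_of E [tuple row i A | i < k]]].

HB.instance Definition _ :=
  Measurable.copy G (g_sigma_algebraType grassmann_open).

(* The second condition says mu (U . A) = mu A, for the direct image of A. *)
Definition is_haar (mu : {measure set G -> \bar R}) : Prop :=
  mu setT = 1%E /\
  forall U : 'M[K]_m, is_isometry U ->
  forall A : set G, measurable A ->
    mu [set E | exists2 E0 : G, A E0 &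
                  (linfun (mulmxr U) @: E0)%VS = E :> {vspace _}] = mu A.

End Grassmann.

Section Probability.
Context {R : realType}.

Definition independent_RV d d1 d2 (T : measurableType d)
    (T1 : measurableType d1) (T2 : measurableType d2)
    (P : probability T R) (X : {RV P >-> T1}) (Y : {RV P >-> T2}) : Prop :=
  forall A B, measurable A -> measurable B ->
    P (X @^-1` A `&` Y @^-1` B) = (P (X @^-1` A) * P (Y @^-1` B))%E.

Definition empirical_measure n (x : n.-tuple R) : {measure set (measurableTypeR R) -> \bar R} :=
  mscale (n%:R^-1)%:nng (msum (fun i => \d_(x`_i : measurableTypeR R)) n).

(* The n-th random measure may live on its own probability space. *)
Definition weak_cvg_in_probability (d : nat -> measure_display)
    (T : forall n, measurableType (d n)) (P : forall n, probability (T n) R)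
    (mu : forall n, T n -> {measure set (measurableTypeR R) -> \bar R})
    (nu : {measure set (measurableTypeR R) -> \bar R}) : Prop :=
  forall f : R -> R, continuous f -> bounded_fun f ->
  forall eps : R, 0 < eps ->
    P n [set w | eps < `|\int[mu n w]_x f x - \int[nu]_x f x|]
      @[n --> \oo] --> 0%E.

Lemma pihalf_gt0 : 0 < pi / 2 :> R.
Proof. by rewrite divr_gt0 // pi_gt0. Qed.

End Probability.

Lemma leq_mul2n n : (n <= 2 * n)%N.
Proof. by rewrite leq_pmull. Qed.

(* Main.v *)
Require Import Defs.
From HB Require Import structures.
From mathcomp Require Import all_boot all_order all_algebra.
From mathcomp Require Import complex.
From mathcomp Require Import all_classical all_reals all_analysis.
From mathcomp Require Import measurable_realfun.
From mathcomp Require Import ring lra.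

Set Implicit Arguments.
Unset Strict Implicit.
Unset Printing Implicit Defensive.

Import Order.TTheory GRing.Theory Num.Theory.
Import numFieldNormedType.Exports.

Local Open Scope classical_set_scope.
Local Open Scope ring_scope.

(** Let [S] and [T] be the orthogonal reflections through the subspaces [E] and
    [F], of dimension [n] in dimension [N = 2 n], and let [W = T * S]. In each
    principal plane [W] is a rotation of angle twice the principal angle, hence
    [\tr (W ^+ k) = 2 * \sum_i cos (2 k theta_i)] ([moment_angles]). The uniform
    law on [[0, pi / 2]] integrates [cos (2 k x)] to [0] for [0 < k]
    ([uniform_cos]), and linear combinations of these functions are uniformly
    dense in the continuous functions on that interval ([trig_poly_dense]). The
    theorem thus amounts to the asymptotic freeness of [S] and [T]: the moment
    [m_k = \tr (W ^+ k) / N] tends to [0] in mean square for every [0 < k].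

    This follows from a loop equation. Freeze [S]. The law of [F] is invariant
    under the rotations of the coordinate plane of [a] and [b], which move [T]
    with velocity [T * X - X * T], where [X] is the generator
    [delta_mx a b - delta_mx b a]. The induced derivative of
    [(W ^+ k) a b * \tr (W ^+ k)] therefore has mean zero
    ([expect_derivative_eq0]). Sum over [a] and [b]. Differentiating the letter
    [T] at position [j] of [W ^+ k] gives the product of the traces of two odd
    words, minus [\tr (W ^+ j) * \tr (W ^+ (k - j))]. An odd word is conjugate to
    [S] or [T], whose trace vanishes because the subspaces have half the
    dimension of the space ([odd_word_tr]). All other terms are pairings of two
    unitary matrices, at most [N] in modulus. What remains is
    [E (m_k ^+ 2) <= \sum_(0 < j < k) E `|m_j| + 6 k / N] ([expect_moment_sqr]),
    and induction on [k] concludes ([moment_sqr_cvg0]). The rotations used have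
    real entries, and the trace of [W ^+ k] is real, so the real and the complex
    case are the same computation.

    The bound is uniform in [S]; independence and Fubini then let [S] be the
    reflection through the random [E] ([expect_pair_moment_le]). The derivatives
    are handled as expansions with a remainder that is uniform in [F]
    ([expands]), so that nothing is differentiated under an integral. Finally,
    nothing is known about how the angles depend on the sample point; but the
    mean of a continuous function over the angles is a limit of combinations of
    the traces above, and this makes it measurable ([angle_mean_measurable]). *)

(** * Scalars *)

(** A [scalarField] carries no axioms. This record gathers what the proof needs
    from the scalars, in a form that the real numbers satisfy with [im = 0], so
    that both fields are treated at once. *)
Record scalar_parts (R : realType) (K : scalarField R) := ScalarParts {
  re : {additive K -> R} ;
  im : {additive K -> R} ;
  reM : forall x y, re (x * y) = re x * re y - im x * im y ;
  imM : forall x y, im (x * y) = re x * im y + im x * re y ;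
  re_real : forall r, re (sreal K r) = r ;
  im_real : forall r, im (sreal K r) = 0 ;
  re_conj : forall x, re (sconj K x) = re x ;
  im_conj : forall x, im (sconj K x) = - im x ;
  parts_inj : forall x y, re x = re y -> im x = im y -> x = y ;
  normK2 : forall x, x * sconj K x = `|x| ^+ 2 ;
  re_homo : {homo re : x y / x <= y} ;
  normE : forall x, `|x| = sreal K (Num.sqrt (re x ^+ 2 + im x ^+ 2))}.

Lemma real_parts (R : realType) : scalar_parts (realScalars R).
Proof.
pose z : {additive R -> R} := \0.
exists (idfun : {additive R -> R}) z => //=.
- by move=> x y; rewrite mulr0 subr0.
- by move=> x y; rewrite mulr0 mul0r addr0.
- by move=> x; rewrite oppr0.
- by move=> x; rewrite -normrX ger0_norm -?expr2 ?sqr_ge0.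
- by move=> x; rewrite expr0n addr0 sqrtr_sqr.
Qed.

Lemma complex_parts (R : realType) : scalar_parts (complexScalars R).
Proof.
exists (@complex.Re R : {additive _ -> _}) (@complex.Im R : {additive _ -> _}) => //=.
- by case=> a b [c e].
- by case=> a b [c e] /=; rewrite [b * c]mulrC.
- by case.
- by case.
- by case=> a b [c e] /= -> ->.
- by move=> x; rewrite sqr_normc.
- by case=> a b [c e]; rewrite lecE => /andP[].
- by case=> a b.
Qed.

(** * Moduli and unitary matrices *)

Section Modulus.
Context (R : realType) (K : scalarField R) (Phi : scalar_parts K).
Local Notation re := (re Phi).
Local Notation im := (im Phi).
Implicit Types x y : K.

(** The modulus, as a real number rather than as an element of [K]. *)
Definition nrm x : R := Num.sqrt (re x ^+ 2 + im x ^+ 2).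

Lemma nrm_ge0 x : 0 <= nrm x. Proof. exact: sqrtr_ge0. Qed.

Lemma sqr_nrm x : nrm x ^+ 2 = re x ^+ 2 + im x ^+ 2.
Proof. by rewrite sqr_sqrtr // addr_ge0 // sqr_ge0. Qed.

Lemma re_norm x : re `|x| = nrm x.
Proof. by rewrite (normE Phi) (re_real Phi). Qed.

Lemma nrmM x y : nrm (x * y) = nrm x * nrm y.
Proof.
by rewrite -!re_norm normrM (reM Phi) !(normE Phi) !(im_real Phi) mulr0 subr0.
Qed.

Lemma nrmD x y : nrm (x + y) <= nrm x + nrm y.
Proof.
by rewrite -!re_norm -raddfD; apply: (re_homo Phi); exact: ler_normD.
Qed.

Lemma nrmN x : nrm (- x) = nrm x.
Proof. by rewrite -!re_norm normrN. Qed.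

Lemma nrmB x y : nrm (x - y) <= nrm x + nrm y.
Proof. by rewrite -(nrmN y) nrmD. Qed.

Lemma nrm0 : nrm 0 = 0.
Proof. by rewrite -re_norm normr0 raddf0. Qed.

Lemma nrm1 : nrm 1 = 1.
Proof. by rewrite -re_norm normr1 -(rmorph1 (sreal K)) (re_real Phi). Qed.

Lemma nrm_real r : nrm (sreal K r) = `|r|.
Proof. by rewrite /nrm (re_real Phi) (im_real Phi) expr0n addr0 sqrtr_sqr. Qed.

Lemma nrm_conj x : nrm (sconj K x) = nrm x.
Proof. by rewrite /nrm (re_conj Phi) (im_conj Phi) sqrrN. Qed.

Lemma le_re_nrm x : `|re x| <= nrm x.
Proof.
rewrite -(ler_pXn2r (_ : 0 < 2)%N) ?nnegrE ?nrm_ge0 // sqr_nrm.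
by rewrite -normrX ger0_norm ?sqr_ge0 // lerDl sqr_ge0.
Qed.

Lemma le_im_nrm x : `|im x| <= nrm x.
Proof.
rewrite -(ler_pXn2r (_ : 0 < 2)%N) ?nnegrE ?nrm_ge0 // sqr_nrm.
by rewrite -normrX ger0_norm ?sqr_ge0 // lerDr sqr_ge0.
Qed.

Lemma nrm_sum (I : Type) (r : seq I) (P : pred I) (F : I -> K) :
  nrm (\sum_(i <- r | P i) F i) <= \sum_(i <- r | P i) nrm (F i).
Proof.
elim/big_ind2: _ => //; first by rewrite nrm0.
by move=> x1 x2 y1 y2 h1 h2; apply: (le_trans (nrmD _ _)); exact: lerD.
Qed.

Lemma reMreal r x : re (sreal K r * x) = r * re x.
Proof. by rewrite (reM Phi) (re_real Phi) (im_real Phi) mul0r subr0. Qed.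

Lemma re_mul_conj x : x * sconj K x = sreal K (nrm x ^+ 2).
Proof. by rewrite (normK2 Phi) (normE Phi) -rmorphXn. Qed.

Lemma sconj_real r : sconj K (sreal K r) = sreal K r.
Proof.
by apply: (@parts_inj _ _ Phi); rewrite ?(re_conj Phi) // (im_conj Phi) (im_real Phi) oppr0.
Qed.

Lemma sconjK x : sconj K (sconj K x) = x.
Proof.
by apply: (@parts_inj _ _ Phi); rewrite !(re_conj Phi, im_conj Phi) ?opprK.
Qed.

Lemma sconj_fixed x : sconj K x = x -> x = sreal K (re x).
Proof.
move=> xx; apply: (@parts_inj _ _ Phi); rewrite ?(re_real Phi) // (im_real Phi).
by have := im_conj Phi x; rewrite xx; lra.
Qed.

End Modulus.

Section Adjoint.
Context (R : realType) (K : scalarField R) (Phi : scalar_parts K).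

(** The conjugate transpose. *)
Definition dag m n (A : 'M[K]_(m, n)) : 'M[K]_(n, m) := (map_mx (sconj K) A)^T.

Lemma dagE m n (A : 'M[K]_(m, n)) i j : dag A i j = sconj K (A j i).
Proof. by rewrite !mxE. Qed.

Lemma dagM m n p (A : 'M[K]_(m, n)) (B : 'M[K]_(n, p)) :
  dag (A *m B) = dag B *m dag A.
Proof. by rewrite /dag map_mxM trmx_mul. Qed.

Lemma dagD m n (A B : 'M[K]_(m, n)) : dag (A + B) = dag A + dag B.
Proof. by apply/matrixP => i j; rewrite !mxE rmorphD. Qed.

Lemma dagN m n (A : 'M[K]_(m, n)) : dag (- A) = - dag A.
Proof. by apply/matrixP => i j; rewrite !mxE rmorphN. Qed.

Lemma dag1 m : dag (1%:M : 'M[K]_m) = 1%:M.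
Proof. by rewrite /dag map_mx1 trmx1. Qed.

Lemma dagK m n (A : 'M[K]_(m, n)) : dag (dag A) = A.
Proof. by apply/matrixP => i j; rewrite !mxE (sconjK Phi). Qed.

Lemma dag_tr m (A : 'M[K]_m) : \tr (dag A) = sconj K (\tr A).
Proof. by rewrite /mxtrace raddf_sum; apply: eq_bigr => i _; rewrite dagE. Qed.

Context (m : nat).
Implicit Types U V : 'M[K]_m.

Lemma isometryV U : is_isometry U -> dag U *m U = 1%:M.
Proof. exact: mulmx1C. Qed.

Lemma isometry_dag U : is_isometry U -> is_isometry (dag U).
Proof. by move=> /isometryV hU; rewrite /is_isometry -/(dag _) dagK. Qed.

Lemma isometry_mul U V : is_isometry U -> is_isometry V -> is_isometry (U * V).
Proof.
rewrite /is_isometry -!/(dag _) => hU hV.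
by rewrite -mulmxE dagM mulmxA -(mulmxA U) hV mulmx1.
Qed.

Lemma isometry1 : is_isometry (1 : 'M[K]_m).
Proof. by rewrite /is_isometry -/(dag _) dag1 mulmx1. Qed.

Lemma isometryX U k : is_isometry U -> is_isometry (U ^+ k).
Proof.
move=> hU; elim: k => [|k ih]; first by rewrite expr0; exact: isometry1.
by rewrite exprS; exact: isometry_mul.
Qed.

Lemma isometry_trmx U : is_isometry U -> is_isometry U^T.
Proof.
move=> /isometryV hU; rewrite /is_isometry -[RHS]trmx1 -hU trmx_mul.
by congr (_ *m _); apply/matrixP => i j; rewrite !mxE.
Qed.

Lemma isometry_row U i : is_isometry U -> \sum_j nrm Phi (U i j) ^+ 2 = 1.
Proof.
move=> /matrixP/(_ i i); rewrite !mxE eqxx mulr1n => h.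
apply: (@fmorph_inj _ _ (sreal K)); rewrite rmorph1 raddf_sum -h.
by apply: eq_bigr => j _; rewrite !mxE (re_mul_conj Phi).
Qed.

Lemma isometry_entry U i j : is_isometry U -> nrm Phi (U i j) <= 1.
Proof.
move=> hU; have := isometry_row i hU; rewrite (bigD1 j) //= => h.
rewrite -(ler_pXn2r (_ : 0 < 2)%N) ?nnegrE ?nrm_ge0 // expr1n -h.
by rewrite lerDl sumr_ge0 // => l _; exact: sqr_ge0.
Qed.

Lemma isometry_tr U : is_isometry U -> nrm Phi (\tr U) <= m%:R.
Proof.
move=> hU; apply: (le_trans (nrm_sum _ _ _ _)).
apply: (le_trans (y := \sum_(i < m) 1)).
  by apply: ler_sum => i _; exact: isometry_entry.
by rewrite sumr_const card_ord.
Qed.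

Definition mxdot U V : K := \sum_a \sum_b U a b * V a b.

(** The rows of unitary matrices are unit vectors: by Cauchy-Schwarz each of the
    [m] rows contributes at most [1]. *)
Lemma isometry_dot U V : is_isometry U -> is_isometry V ->
  nrm Phi (mxdot U V) <= m%:R.
Proof.
move=> hU hV; apply: (le_trans (nrm_sum _ _ _ _)).
apply: (le_trans (y := \sum_(i < m) 1)); last by rewrite sumr_const card_ord.
apply: ler_sum => i _; apply: (le_trans (nrm_sum _ _ _ _)).
have -> : 1 = (\sum_j nrm Phi (U i j) ^+ 2 + \sum_j nrm Phi (V i j) ^+ 2) / 2.
  by rewrite !isometry_row //; field.
rewrite -big_split /= mulr_suml; apply: ler_sum => j _.
rewrite nrmM; move: (nrm Phi (U i j)) (nrm Phi (V i j)) => a b.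
by have := sqr_ge0 (a - b); nra.
Qed.

End Adjoint.

(** * Words in two reflections *)

Section Words.
Context (R : realType) (K : scalarField R) (Phi : scalar_parts K) (m : nat).
Implicit Types S T X L Q : 'M[K]_m.
Local Notation re := (re Phi).

(** These are exactly the orthogonal reflections through subspaces of half the
    dimension; the trace condition is what fixes the dimension. *)
Definition balanced_symmetry S := [/\ S * S = 1, dag S = S & \tr S = 0].

Lemma symmetry_isometry S : balanced_symmetry S -> is_isometry S.
Proof. by case=> S2 aS _; rewrite /is_isometry -/(dag _) aS. Qed.

Lemma mxtr_mulC (A B : 'M[K]_m) : \tr (A * B) = \tr (B * A).
Proof. exact: mxtrace_mulC. Qed.

Section TwoSymmetries.
Variables S T : 'M[K]_m.
Hypotheses (hS : balanced_symmetry S) (hT : balanced_symmetry T).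
Local Notation W := (T * S).
Local Notation V := (S * T).

Let S2 : S * S = 1. Proof. by case: hS. Qed.
Let T2 : T * T = 1. Proof. by case: hT. Qed.
Let trS : \tr S = 0. Proof. by case: hS. Qed.
Let trT : \tr T = 0. Proof. by case: hT. Qed.

Lemma word_isometry k : is_isometry (W ^+ k).
Proof. by apply/isometryX/isometry_mul => //; exact: symmetry_isometry. Qed.

Lemma word_dag k : dag (W ^+ k) = V ^+ k.
Proof.
elim: k => [|k ih]; first by rewrite !expr0; exact: (dag1 K m).
rewrite exprS exprSr dagM ih mulmxE dagM mulmxE.
by case: hS => _ -> _; case: hT => _ -> _.
Qed.

Lemma word_shift k : S * W ^+ k * T = V ^+ k.+1.
Proof.
elim: k => [|k ih]; first by rewrite expr0 expr1 mulr1.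
by rewrite exprSr exprSr -ih !mulrA.
Qed.

Lemma word_tr_dag k : \tr (V ^+ k) = \tr (W ^+ k).
Proof.
case: k => // k; rewrite -word_shift mxtr_mulC mulrA exprS.
by [].
Qed.

(** The adjoint of [W] is the reversed word, which has the same trace by
    cyclicity; so the traces of the powers of [W] are real. *)
Lemma word_tr_fixed k : sconj K (\tr (W ^+ k)) = \tr (W ^+ k).
Proof. by rewrite -dag_tr word_dag word_tr_dag. Qed.

(** A word of odd length in two involutions is a conjugate of one of its
    letters, hence has trace zero. *)
Lemma odd_word_tr k : \tr (W ^+ k * T) = 0 /\ \tr (W ^+ k * S) = 0.
Proof.
elim: k => [|k [ihT ihS]]; first by rewrite expr0 !mul1r.
split; last by rewrite exprSr -!mulrA S2 mulr1.
by rewrite exprS mxtr_mulC !mulrA T2 mul1r mxtr_mulC.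
Qed.

(** Taking the real part loses nothing, see [word_trE]. *)
Definition moment S' T' k : R := re (\tr ((T' * S') ^+ k)) / m%:R.

Lemma word_trE k : (0 < m)%N ->
  \tr (W ^+ k) = sreal K (m%:R * moment S T k).
Proof.
move=> m0; rewrite {1}(sconj_fixed Phi (word_tr_fixed k)) /moment.
by rewrite mulrCA mulfV ?mulr1 // pnatr_eq0 -lt0n.
Qed.

Lemma moment_le1 k : `|moment S T k| <= 1.
Proof.
rewrite /moment normrM normfV normr_nat.
have [m0|m0] := posnP m.
  by rewrite [X in X%:R^-1]m0 invr0 mulr0.
rewrite ler_pdivrMr ?ltr0n // mul1r.
exact: le_trans (le_re_nrm _ _) (isometry_tr Phi (word_isometry k)).
Qed.

Lemma moment0 : (0 < m)%N -> moment S T 0 = 1.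
Proof.
move=> m0; rewrite /moment expr0 mxtrace1.
have -> : (m%:R : K) = sreal K m%:R by rewrite rmorph_nat.
by rewrite re_real divff // pnatr_eq0 -lt0n.
Qed.

(** The infinitesimal rotation in the coordinate plane of [a] and [b]. *)
Definition plane_gen a b : 'M[K]_m := delta_mx a b - delta_mx b a.

(** The derivative of [T] when the subspace is rotated with velocity [X], and
    the derivatives it induces on the powers of [W]. *)
Definition dsym X := T * X - X * T.
Definition dword k X :=
  \sum_(j < k) W ^+ j * (dsym X * S) * W ^+ (k - j.+1).

Lemma delta_sandwich (i j : 'I_m) (M1 M2 : 'M[K]_m) p q :
  (M1 * delta_mx i j * M2) p q = M1 p i * M2 j q.
Proof.
rewrite -!mulmxE -(mul_delta_mx (0 : 'I_1)) mulmxA -colE -mulmxA -rowE.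
by rewrite mxE big_ord1 !mxE.
Qed.

Lemma plane_gen_sandwich L Q a b :
  (L * plane_gen a b * Q) a b = L a a * Q b b - L a b * Q a b.
Proof. by rewrite -!delta_sandwich /plane_gen mulrBr mulrBl !mxE. Qed.

(** Summing over all planes turns two factors around the generator into a
    product of traces; the antisymmetry of the generator costs a pairing. *)
Lemma plane_gen_sandwich_sum L Q :
  \sum_a \sum_b (L * plane_gen a b * Q) a b = \tr L * \tr Q - mxdot L Q.
Proof.
rewrite /mxdot mulr_suml -sumrB; apply: eq_bigr => a _.
rewrite mulr_sumr -sumrB; apply: eq_bigr => b _; exact: plane_gen_sandwich.
Qed.

Lemma plane_gen_tr a b Q : \tr (plane_gen a b * Q) = Q b a - Q a b.
Proof.
have E i j : \tr (delta_mx i j * Q) = Q j i.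
  rewrite -[delta_mx i j]mul1r /mxtrace (bigD1 i) //= big1 ?addr0.
    by rewrite delta_sandwich mxE eqxx mul1r.
  by move=> l li; rewrite delta_sandwich mxE (negPf li) mul0r.
by rewrite /plane_gen mulrBl raddfB /= !E.
Qed.

Lemma dsymS X : dsym X * S = T * X * S - X * W.
Proof. by rewrite /dsym mulrBl !mulrA. Qed.

(** Odd words being traceless, only the terms [\tr (W ^+ j) * \tr (W ^+ (k - j))]
    survive, up to pairings of unitary matrices, which are of lower order. *)
Lemma dword_sum k : exists2 err : K, nrm Phi err <= (2 * k * m)%:R &
  \sum_a \sum_b dword k (plane_gen a b) a b =
    err - \sum_(j < k) \tr (W ^+ j) * \tr (W ^+ (k - j)).
Proof.
pose e (j : 'I_k) := mxdot (W ^+ j) (W ^+ (k - j))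
  - mxdot (W ^+ j * T) (S * W ^+ (k - j.+1)).
exists (\sum_j e j).
  apply: (le_trans (nrm_sum _ _ _ _)).
  rewrite mulnAC natrM mulr_natr -[X in _ *+ X]card_ord -sumr_const.
  apply: ler_sum => j _; apply: (le_trans (nrmB _ _ _)).
  rewrite mul2n -addnn natrD; apply: lerD; apply: isometry_dot.
  - exact: word_isometry.
  - exact: word_isometry.
  - by apply: isometry_mul; [exact: word_isometry|exact: symmetry_isometry].
  - by apply: isometry_mul; [exact: symmetry_isometry|exact: word_isometry].
rewrite -sumrB.
transitivity (\sum_(j < k) \sum_a \sum_b
    (W ^+ j * (dsym (plane_gen a b) * S) * W ^+ (k - j.+1)) a b).
  rewrite [RHS]exchange_big /=; apply: eq_bigr => a _.
  rewrite [RHS]exchange_big /=; apply: eq_bigr => b _.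
  by rewrite /dword summxE.
apply: eq_bigr => j _.
transitivity (\sum_a \sum_b ((W ^+ j * T * plane_gen a b * (S * W ^+ (k - j.+1))) a b
    - (W ^+ j * plane_gen a b * W ^+ (k - j)) a b)).
  apply: eq_bigr => a _; apply: eq_bigr => b _.
  have -> : W ^+ (k - j) = W * W ^+ (k - j.+1) by rewrite -exprS subnSK.
  by rewrite dsymS mulrBr mulrBl !mulrA !mxE.
under eq_bigr do rewrite sumrB.
rewrite sumrB !plane_gen_sandwich_sum (odd_word_tr j).1 mul0r sub0r /e.
by rewrite opprB addrA; congr (_ - _); rewrite addrC.
Qed.

(** By cyclicity all positions contribute equally to the derivative of the
    trace, so that this term is [k] times a sum of four pairings of unitary
    matrices. *)
Lemma dword_tr_sum k :
  nrm Phi (\sum_a \sum_b (W ^+ k) a b * \tr (dword k (plane_gen a b)))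
    <= (4 * k * m)%:R.
Proof.
have -> : \sum_a \sum_b (W ^+ k) a b * \tr (dword k (plane_gen a b)) =
   (mxdot (W ^+ k) (V ^+ k)^T - mxdot (W ^+ k) (V ^+ k)
    - (mxdot (W ^+ k) (W ^+ k)^T - mxdot (W ^+ k) (W ^+ k))) *+ k.
  rewrite /mxdot -!sumrB -sumrMnl; apply: eq_bigr => a _.
  rewrite -!sumrB -sumrMnl; apply: eq_bigr => b _.
  rewrite !mxE -!mulrBr -mulrnAr; congr (_ * _).
  case: k => [|k]; first by rewrite /dword big_ord0 mulr0n raddf0.
  transitivity (\sum_(j < k.+1) \tr (dsym (plane_gen a b) * S * W ^+ k)).
    rewrite /dword raddf_sum; apply: eq_bigr => j _ /=.
    by rewrite -mulrA mxtr_mulC -mulrA -exprD subSS subnK // -ltnS.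
  rewrite sumr_const card_ord; congr (_ *+ _).
  have tV X : \tr (T * X * S * W ^+ k) = \tr (X * V ^+ k.+1).
    by rewrite -word_shift -!mulrA mxtr_mulC -!mulrA.
  have tW X : \tr (X * W * W ^+ k) = \tr (X * W ^+ k.+1).
    by rewrite exprS !mulrA.
  by rewrite dsymS mulrBl raddfB /= tV tW !plane_gen_tr.
have natE (x : K) : nrm Phi (x *+ k) = nrm Phi x * k%:R.
  by rewrite -(mulr_natr x) nrmM -(rmorph_nat (sreal K)) nrm_real normr_nat.
rewrite natE mulnAC natrM ler_wpM2r //.
have d (Q : 'M[K]_m) : is_isometry Q -> nrm Phi (mxdot (W ^+ k) Q) <= m%:R.
  by move=> hQ; apply: isometry_dot => //; exact: word_isometry.
have hV : is_isometry (V ^+ k) by rewrite -word_dag; exact/(isometry_dag Phi)/word_isometry.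
have hW := word_isometry k.
have d1 := d _ hV; have d2 := d _ (isometry_trmx hV).
have d3 := d _ hW; have d4 := d _ (isometry_trmx hW).
have -> : (4 * m)%:R = (m%:R + m%:R) + (m%:R + m%:R) :> R by rewrite natrM; ring.
by apply: (le_trans (nrmB _ _ _)); apply: lerD; apply: (le_trans (nrmB _ _ _)); apply: lerD.
Qed.

(** The derivative of [(W ^+ k) a b * \tr (W ^+ k)] under the rotation of [T] in
    the plane of [a] and [b]. The factor [\tr (W ^+ k)] is there to produce the
    square of the moment, hence concentration and not just a vanishing mean. *)
Definition dmoment k a b : K :=
  dword k (plane_gen a b) a b * \tr (W ^+ k)
  + (W ^+ k) a b * \tr (dword k (plane_gen a b)).

(** The loop equation before integration. The sum of the derivatives contains
    [- m ^+ 3] times the square of the [k]-th moment (the term of index [0] in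
    [dword_sum]), products of moments, of which all factors but one are bounded
    by [1], and errors of order [k m ^+ 2]. *)
Lemma loop_inequality k : (0 < m)%N -> (0 < k)%N ->
  moment S T k ^+ 2 <= - (\sum_a \sum_b re (dmoment k a b)) / m%:R ^+ 3
    + \sum_(1 <= j < k) `|moment S T j| + 6 * k%:R / m%:R.
Proof.
move=> m0 k0.
have [err err_le eqD] := dword_sum k.
have := dword_tr_sum k; set t := \sum_a _ => t_le.
have eqM : \sum_a \sum_b dmoment k a b =
    (err - \sum_(j < k) \tr (W ^+ j) * \tr (W ^+ (k - j))) * \tr (W ^+ k) + t.
  rewrite -eqD /t mulr_suml -big_split /=; apply: eq_bigr => a _.
  by rewrite mulr_suml -big_split.
have -> : \sum_a \sum_b re (dmoment k a b) = re (\sum_a \sum_b dmoment k a b).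
  by rewrite raddf_sum; apply: eq_bigr => a _; rewrite raddf_sum.
have M0 : 0 < m%:R :> R by rewrite ltr0n.
rewrite eqM raddfD /= (word_trE k m0) (mulrC (err - _)) reMreal raddfB /=.
rewrite raddf_sum /=.
under eq_bigr do rewrite !word_trE // -rmorphM re_real.
have -> : \sum_(i < k) m%:R * moment S T i * (m%:R * moment S T (k - i))
  = m%:R ^+ 2 * (moment S T k + \sum_(1 <= i < k) moment S T i * moment S T (k - i)).
  rewrite -(big_mkord xpredT (fun i => m%:R * moment S T i * (m%:R * moment S T (k - i)))).
  rewrite big_ltn // moment0 // subn0 mulrDr mulr_sumr; congr (_ + _); first by ring.
  by apply: eq_bigr => i _; ring.
have e1 : `|re err| <= 2 * k%:R * m%:R.
  by apply: (le_trans (le_re_nrm _ _)); rewrite -!natrM.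
have t1 : `|re t| <= 4 * k%:R * m%:R.
  by apply: (le_trans (le_re_nrm _ _)); rewrite -!natrM.
have mk := moment_le1 k.
have s1 : `|(\sum_(1 <= i < k) moment S T i * moment S T (k - i)) * moment S T k|
    <= \sum_(1 <= j < k) `|moment S T j|.
  rewrite normrM -[leRHS]mulr1; apply: ler_pM => //.
  apply: (le_trans (ler_norm_sum _ _ _)); apply: ler_sum => i _.
  by rewrite normrM ler_piMr // moment_le1.
move: s1; set s := \sum_(1 <= i < k) moment S T i * _; set B := \sum_(_ <= _ < _) _.
move: (moment S T k) mk (re err) e1 (re t) t1 => x x1 y y1 z z1 s1.
have -> : - (m%:R * x * (y - m%:R ^+ 2 * (x + s)) + z) / m%:R ^+ 3
   = x ^+ 2 + s * x - (x * y) / m%:R ^+ 2 - z / m%:R ^+ 3.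
  by field; rewrite gt_eqF.
have M1 : 1 <= m%:R :> R by rewrite ler1n.
have h1 : x * y / m%:R ^+ 2 <= 2 * k%:R / m%:R.
  rewrite ler_pdivrMr ?exprn_gt0 //.
  have -> : 2 * k%:R / m%:R * m%:R ^+ 2 = 2 * k%:R * m%:R :> R.
    by field; rewrite gt_eqF.
  apply: (le_trans (ler_norm _)); rewrite normrM.
  by rewrite -[leRHS]mul1r; apply: ler_pM.
have h2 : z / m%:R ^+ 3 <= 4 * k%:R / m%:R.
  rewrite ler_pdivrMr ?exprn_gt0 //.
  have -> : 4 * k%:R / m%:R * m%:R ^+ 3 = 4 * k%:R * m%:R * m%:R :> R.
    by field; rewrite gt_eqF.
  apply: (le_trans (ler_norm _)); apply: (le_trans z1).
  by rewrite ler_peMr // !mulr_ge0.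
have h3 : - B <= s * x by move: s1; rewrite ler_norml => /andP[].
have -> : 6 * k%:R / m%:R = 2 * k%:R / m%:R + 4 * k%:R / m%:R :> R.
  by field; rewrite gt_eqF.
lra.
Qed.

End TwoSymmetries.
End Words.

(** * Orthogonal projections as functions of a spanning matrix *)

Section MatrixContinuity.
Context (R : realType) (K : scalarField R) (Phi : scalar_parts K).

(** The balls of [K] have radii in [K], so that real radii have to be embedded. *)
Lemma sreal_gt0 (e : R) : 0 < e -> 0 < sreal K e.
Proof.
move=> e0; have e1 : nrm Phi (sreal K e) = e by rewrite nrm_real gtr0_norm.
by rewrite -e1 -(normE Phi) normr_gt0 fmorph_eq0 gt_eqF.
Qed.

Lemma continuous_of_nrm (f : {additive K -> R}) :
  (forall x, `|f x| <= nrm Phi x) -> continuous (f : K -> R).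
Proof.
move=> hf x; apply/(@cvgrPdist_le _ _ _ _ (nbhs_filter x)) => e e0.
have : \forall y \near x, `|x - y| < sreal K e.
  by apply/nbhs_normP; exists (sreal K e) => //=; exact: sreal_gt0.
apply: filterS => y /= xy; rewrite -raddfB; apply: (le_trans (hf _)).
by rewrite -re_norm -[leRHS](re_real Phi); apply/(re_homo Phi)/ltW.
Qed.

Lemma re_continuous : continuous (re Phi : K -> R).
Proof. by apply: continuous_of_nrm => x; exact: le_re_nrm. Qed.

Lemma im_continuous : continuous (im Phi : K -> R).
Proof. by apply: continuous_of_nrm => x; exact: le_im_nrm. Qed.

Lemma sconj_continuous : continuous (sconj K : K -> K).
Proof.
move=> x; apply/(@cvgrPdist_lt _ _ _ _ (nbhs_filter x)) => e e0.
have : \forall y \near x, `|x - y| < e by apply/nbhs_normP; exists e.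
by apply: filterS => y /=; rewrite -rmorphB /= !(normE Phi) -!/(nrm _ _) nrm_conj.
Qed.

Context (T : Type) (F : set_system T) {FF : Filter F}.

Lemma cvg_bigsum (I : Type) (r : seq I) (P : pred I) (f : I -> T -> K) (a : I -> K) :
  (forall i, f i x @[x --> F] --> a i) ->
  (\sum_(i <- r | P i) f i x) @[x --> F] --> \sum_(i <- r | P i) a i.
Proof.
move=> h; elim: r => [|i r ih].
  rewrite big_nil; under eq_fun do rewrite big_nil; exact: cvg_cst.
rewrite big_cons; under eq_fun do rewrite big_cons.
by case: (P i) => //; apply: cvgD.
Qed.

Lemma cvg_bigprod (I : Type) (r : seq I) (P : pred I) (f : I -> T -> K) (a : I -> K) :
  (forall i, f i x @[x --> F] --> a i) ->
  (\prod_(i <- r | P i) f i x) @[x --> F] --> \prod_(i <- r | P i) a i.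
Proof.
move=> h; elim: r => [|i r ih].
  rewrite big_nil; under eq_fun do rewrite big_nil; exact: cvg_cst.
rewrite big_cons; under eq_fun do rewrite big_cons.
by case: (P i) => //; apply: cvgM.
Qed.

Definition mx_entrywise_cvg p q (f : T -> 'M[K]_(p, q)) (A : 'M[K]_(p, q)) :=
  forall i j, f x i j @[x --> F] --> A i j.

Lemma mx_cvg p q (f : T -> 'M[K]_(p, q)) A : mx_entrywise_cvg f A -> f @ F --> A.
Proof.
move=> h B [P hP sub]; suff : \forall x \near F, forall i j, P i j (f x i j).
  by apply: filterS => x; exact: sub.
by apply: filter_forall => i; apply: filter_forall => j; apply: h.
Qed.

Lemma mulmx_cvg p q r (f : T -> 'M[K]_(p, q)) (g : T -> 'M[K]_(q, r)) A B :
  mx_entrywise_cvg f A -> mx_entrywise_cvg g B ->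
  mx_entrywise_cvg (fun x => f x *m g x) (A *m B).
Proof.
move=> hf hg i j; rewrite mxE; under eq_fun do rewrite mxE.
by apply: cvg_bigsum => l; apply: cvgM.
Qed.

Lemma dag_cvg p q (f : T -> 'M[K]_(p, q)) A :
  mx_entrywise_cvg f A -> mx_entrywise_cvg (fun x => dag (f x)) (dag A).
Proof.
move=> hf i j; rewrite dagE; under eq_fun do rewrite dagE.
by apply: continuous_cvg; [exact: sconj_continuous|exact: hf].
Qed.

Lemma det_cvg p (f : T -> 'M[K]_p) A :
  mx_entrywise_cvg f A -> \det (f x) @[x --> F] --> \det A.
Proof.
move=> hf; rewrite /determinant; apply: cvg_bigsum => s.
apply: cvgM; first exact: cvg_cst.
by apply: cvg_bigprod => i; exact: hf.
Qed.

Lemma adjugate_cvg p (f : T -> 'M[K]_p) A :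
  mx_entrywise_cvg f A -> mx_entrywise_cvg (fun x => \adj (f x)) (\adj A).
Proof.
move=> hf i j; rewrite mxE; under eq_fun do rewrite mxE.
apply: cvgM; first exact: cvg_cst.
apply: det_cvg => a b; rewrite !mxE; under eq_fun do rewrite !mxE.
exact: hf.
Qed.

End MatrixContinuity.

Section Projection.
Context (R : realType) (K : scalarField R) (Phi : scalar_parts K) (k m : nat).
Implicit Types A B : 'M[K]_(k, m).

Definition gram A : 'M[K]_k := A *m dag A.

(** The orthogonal projection onto the row space of [A], as a matrix acting on
    row vectors. *)
Definition rowproj A : 'M[K]_m := dag A *m invmx (gram A) *m A.

Lemma dag_gram A : dag (gram A) = gram A.
Proof. by rewrite /gram dagM (dagK Phi). Qed.

Lemma row_mul_dag_eq0 (w : 'rV[K]_m) : w *m dag w = 0 -> w = 0.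
Proof.
move=> /matrixP/(_ 0 0); rewrite !mxE => /(congr1 (re Phi)).
rewrite raddf0 raddf_sum => h; apply/rowP => j; rewrite mxE.
have /psumr_eq0P := h => /(_ _ j isT) hj.
have {}hj : nrm Phi (w 0 j) ^+ 2 = 0.
  rewrite -[LHS](re_real Phi) -(re_mul_conj Phi) -[RHS]hj ?dagE // => i _.
  by rewrite dagE (re_mul_conj Phi) re_real sqr_ge0.
apply: (@parts_inj _ _ Phi); rewrite raddf0; apply/normr0_eq0/eqP;
  rewrite eq_le normr_ge0 andbT; [have := le_re_nrm Phi (w 0 j)|have := le_im_nrm Phi (w 0 j)].
  by move/eqP: hj; rewrite sqrf_eq0 => /eqP ->.
by move/eqP: hj; rewrite sqrf_eq0 => /eqP ->.
Qed.

(** The Gram matrix detects full rank by a single determinant. This makes the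
    rank condition open and the projection a rational function of [A]. *)
Lemma gram_unitP A :
  reflect (forall v : 'rV[K]_k, v *m A = 0 -> v = 0) (gram A \in unitmx).
Proof.
rewrite unitmxE unitfE; apply: (iffP idP) => [d0 v vA|h].
  apply/eqP; apply: contraNT d0 => v0; apply/det0P; exists v => //.
  by rewrite /gram mulmxA vA mul0mx.
apply/negP => /det0P[v v0 vG]; case/eqP: v0; apply: h.
by apply: row_mul_dag_eq0; rewrite dagM mulmxA -(mulmxA v) vG mul0mx.
Qed.

Lemma free_rowsP A :
  reflect (forall v : 'rV[K]_k, v *m A = 0 -> v = 0) (free [tuple row i A | i < k]).
Proof.
have E v : v *m A = \sum_i v 0 i *: [tuple row i A | i < k]`_i.
  rewrite mulmx_sum_row; apply: eq_bigr => i _.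
  by rewrite -tnth_nth tnth_mktuple.
apply: (iffP freeP) => h.
  move=> v; rewrite E => /(h (fun i => v 0 i)) v0.
  by apply/rowP => i; rewrite mxE v0.
move=> c hc i; have := h (\row_i c i); rewrite E.
under eq_bigr do rewrite mxE.
by move=> /(_ hc)/rowP/(_ i); rewrite !mxE.
Qed.

Lemma gram_unit_free A : (gram A \in unitmx) = free [tuple row i A | i < k].
Proof. by apply/gram_unitP/free_rowsP. Qed.

Lemma mul_proj A : gram A \in unitmx -> A *m rowproj A = A.
Proof. by move=> u; rewrite /rowproj !mulmxA -/(gram A) mulmxV // mul1mx. Qed.

Lemma dag_proj A : gram A \in unitmx -> dag (rowproj A) = rowproj A.
Proof.
move=> u; rewrite /rowproj !dagM (dagK Phi) -mulmxA; congr (_ *m (_ *m _)).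
have h : gram A *m dag (invmx (gram A)) = 1%:M.
  by rewrite -[X in X *m _]dag_gram -dagM mulVmx // dag1.
by rewrite -[LHS]mul1mx -(mulVmx u) -mulmxA h mulmx1.
Qed.

Lemma proj_idem A : gram A \in unitmx -> rowproj A *m rowproj A = rowproj A.
Proof. by move=> u; rewrite {1}/rowproj -mulmxA mul_proj. Qed.

Lemma proj_tr A : gram A \in unitmx -> \tr (rowproj A) = k%:R.
Proof.
by move=> u; rewrite /rowproj -mulmxA mxtrace_mulC -mulmxA -/(gram A) mulVmx // mxtrace1.
Qed.

Lemma proj_orthonormal A : gram A = 1%:M -> rowproj A = dag A *m A.
Proof. by move=> h; rewrite /rowproj h invmx1 mulmx1. Qed.

Lemma proj_mul A (U : 'M[K]_m) : is_isometry U ->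
  rowproj (A *m U) = dag U *m rowproj A *m U.
Proof.
move=> hU; have -> : rowproj (A *m U) = dag (A *m U) *m invmx (gram A) *m (A *m U).
  rewrite /rowproj; congr (_ *m invmx _ *m _).
  by rewrite /gram dagM mulmxA -(mulmxA A) hU mulmx1.
by rewrite dagM /rowproj !mulmxA.
Qed.

(** Each of the two projections absorbs the other, and both are self-adjoint. *)
Lemma proj_row_space A B g h : gram A \in unitmx -> gram B \in unitmx ->
  B = g *m A -> A = h *m B -> rowproj A = rowproj B.
Proof.
move=> uA uB BA AB.
have h1 : rowproj A *m rowproj B = rowproj A.
  have e : A *m rowproj B = A by rewrite {1}AB -mulmxA mul_proj // -AB.
  by rewrite {1}/rowproj -mulmxA e.
have h2 : rowproj B *m rowproj A = rowproj B.
  have e : B *m rowproj A = B by rewrite {1}BA -mulmxA mul_proj // -BA.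
  by rewrite {1}/rowproj -mulmxA e.
by rewrite -h1 -[in LHS](dag_proj uA) -[in LHS](dag_proj uB) -dagM h2 dag_proj.
Qed.

Lemma gram_cvg A : mx_entrywise_cvg (nbhs A) gram (gram A).
Proof.
have idA : mx_entrywise_cvg (nbhs A) id A by move=> i j; exact: coord_continuous.
by apply: mulmx_cvg => //; exact: (dag_cvg Phi).
Qed.

Lemma gram_unit_near A : gram A \in unitmx ->
  \forall B \near A, gram B \in unitmx.
Proof.
rewrite unitmxE unitfE => d0.
apply: (filterS _ (cvgr_neq0 _ (det_cvg (@gram_cvg A)) d0)) => B.
by rewrite unitmxE unitfE.
Qed.

Lemma proj_cvg A : gram A \in unitmx -> mx_entrywise_cvg (nbhs A) rowproj (rowproj A).
Proof.
move=> uA i j.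
have E B : gram B \in unitmx ->
    (dag B *m (\adj (gram B)) *m B) i j / \det (gram B) = rowproj B i j.
  by move=> uB; rewrite /rowproj /invmx uB -scalemxAr -scalemxAl [RHS]mxE [RHS]mulrC.
rewrite -E //; apply: (@cvg_trans _ (((dag B *m (\adj (gram B)) *m B) i j / \det (gram B)) @[B --> A])).
  apply: near_eq_cvg; near=> B; rewrite E //.
  by near: B; exact: gram_unit_near.
have idA : mx_entrywise_cvg (nbhs A) id A by move=> a b; exact: coord_continuous.
have FA := nbhs_filter A.
apply: (@cvgM _ _ (nbhs A) FA).
  apply: mulmx_cvg => //; apply: mulmx_cvg; first exact: (dag_cvg Phi).
  exact: (adjugate_cvg (@gram_cvg A)).
by apply: (@cvgV _ _ (nbhs A) FA); [rewrite -unitfE -unitmxE|exact: (det_cvg (@gram_cvg A))].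
Unshelve. all: by end_near. Qed.

End Projection.

(** * Measurability and rotations on the Grassmannian *)

Section ScalarMeasurability.
Context (R : realType) (K : scalarField R) (Phi : scalar_parts K).
Context (d : measure_display) (X : measurableType d).
Implicit Types f g : X -> K.

Definition kmeasurable f :=
  measurable_fun setT (re Phi \o f) /\ measurable_fun setT (im Phi \o f).

Lemma kmeasurable_cst c : kmeasurable (fun=> c).
Proof. by split; exact: measurable_cst. Qed.

Lemma kmeasurableD f g : kmeasurable f -> kmeasurable g ->
  kmeasurable (fun x => f x + g x).
Proof.
move=> [f1 f2] [g1 g2]; split.
  rewrite (_ : re Phi \o _ = (re Phi \o f) \+ (re Phi \o g)).
    exact: measurable_funD.
  by apply/funext => x /=; rewrite raddfD.
rewrite (_ : im Phi \o _ = (im Phi \o f) \+ (im Phi \o g)).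
  exact: measurable_funD.
by apply/funext => x /=; rewrite raddfD.
Qed.

Lemma kmeasurableM f g : kmeasurable f -> kmeasurable g ->
  kmeasurable (fun x => f x * g x).
Proof.
move=> [f1 f2] [g1 g2]; split.
  rewrite (_ : re Phi \o _ = ((re Phi \o f) \* (re Phi \o g))
                            \- ((im Phi \o f) \* (im Phi \o g))).
    by apply: measurable_funB; exact: measurable_funM.
  by apply/funext => x /=; rewrite (reM Phi).
rewrite (_ : im Phi \o _ = ((re Phi \o f) \* (im Phi \o g))
                          \+ ((im Phi \o f) \* (re Phi \o g))).
  by apply: measurable_funD; exact: measurable_funM.
by apply/funext => x /=; rewrite (imM Phi).
Qed.

Lemma kmeasurable_sum (I : Type) (r : seq I) (f : I -> X -> K) :
  (forall i, kmeasurable (f i)) -> kmeasurable (fun x => \sum_(i <- r) f i x).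
Proof.
move=> h; elim: r => [|i r ih].
  by under eq_fun do rewrite big_nil; exact: kmeasurable_cst.
by under eq_fun do rewrite big_cons; exact: kmeasurableD.
Qed.

Definition mx_measurable p q (f : X -> 'M[K]_(p, q)) :=
  forall i j, kmeasurable (fun x => f x i j).

Lemma mx_measurable_cst p q (A : 'M[K]_(p, q)) : mx_measurable (fun=> A).
Proof. by move=> i j; exact: kmeasurable_cst. Qed.

Lemma mx_measurableD p q (f g : X -> 'M[K]_(p, q)) :
  mx_measurable f -> mx_measurable g -> mx_measurable (fun x => f x + g x).
Proof.
by move=> hf hg i j; under eq_fun do rewrite mxE; exact: kmeasurableD.
Qed.

Lemma mx_measurable_mul p q r (f : X -> 'M[K]_(p, q)) (g : X -> 'M[K]_(q, r)) :
  mx_measurable f -> mx_measurable g -> mx_measurable (fun x => f x *m g x).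
Proof.
move=> hf hg i j; under eq_fun do rewrite mxE.
by apply: kmeasurable_sum => l; exact: kmeasurableM.
Qed.

Lemma mx_measurableB p (f g : X -> 'M[K]_p) :
  mx_measurable f -> mx_measurable g -> mx_measurable (fun x => f x - g x).
Proof.
move=> hf hg; apply: mx_measurableD => // i j.
under eq_fun do rewrite mxE -mulN1r.
by apply: kmeasurableM => //; exact: kmeasurable_cst.
Qed.

Lemma mx_measurableX p (f : X -> 'M[K]_p) k :
  mx_measurable f -> mx_measurable (fun x => f x ^+ k).
Proof.
move=> hf; elim: k => [|k ih].
  by under eq_fun do rewrite expr0; exact: mx_measurable_cst.
by under eq_fun do rewrite exprS; exact: mx_measurable_mul.
Qed.

Lemma mx_measurable_sum (I : Type) (r : seq I) p (f : I -> X -> 'M[K]_p) :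
  (forall i, mx_measurable (f i)) -> mx_measurable (fun x => \sum_(i <- r) f i x).
Proof.
move=> h i j; under eq_fun do rewrite summxE.
by apply: kmeasurable_sum => l; exact: h.
Qed.

Lemma kmeasurable_tr p (f : X -> 'M[K]_p) :
  mx_measurable f -> kmeasurable (fun x => \tr (f x)).
Proof. by move=> hf; apply: kmeasurable_sum => i; exact: hf. Qed.

End ScalarMeasurability.

Section ScalarMeasurabilityComp.
Context (R : realType) (K : scalarField R) (Phi : scalar_parts K).

Lemma mx_measurable_comp d d' (X : measurableType d) (Y : measurableType d')
    p q (f : Y -> 'M[K]_(p, q)) (g : X -> Y) :
  measurable_fun setT g -> mx_measurable Phi f -> mx_measurable Phi (f \o g).
Proof.
move=> mg mf i j; have [h1 h2] := mf i j.
by split; [exact: measurableT_comp h1 mg|exact: measurableT_comp h2 mg].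
Qed.
End ScalarMeasurabilityComp.

Section GrassmannProjection.
Context (R : realType) (K : scalarField R) (Phi : scalar_parts K).
Context (m k : nat) (km : (k <= m)%N).
Local Notation G := (grassmann K km).
Implicit Types F : G.

Definition gbasis F : 'M[K]_(k, m) := \matrix_(i < k) (vbasis F)`_i.

(** Computed from an arbitrary basis; by [gprojE] any basis will do. *)
Definition gproj F : 'M[K]_m := rowproj (gbasis F).

Lemma gdim F : \dim F = k. Proof. by case: F => V /= /eqP. Qed.

Lemma rows_of (A : 'M[K]_(k, m)) (s : seq 'rV[K]_m) :
  size s = k -> (forall i : 'I_k, row i A = s`_i) ->
  [tuple row i A | i < k] = s :> seq _.
Proof.
move=> ss h; apply: (@eq_from_nth _ 0); first by rewrite size_tuple ss.
move=> i; rewrite size_tuple => ik.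
by have := tnth_nth 0 [tuple row i A | i < k] (Ordinal ik) => <-; rewrite tnth_mktuple h.
Qed.

Lemma gbasisP F : basis_of F [tuple row i (gbasis F) | i < k].
Proof.
rewrite (@rows_of _ (vbasis F)) ?vbasisP // ?size_tuple ?gdim //.
by move=> i; rewrite rowK.
Qed.

Lemma basis_gram_unit F A : basis_of F [tuple row i A | i < k] ->
  gram A \in unitmx.
Proof. by move=> /basis_free; rewrite (gram_unit_free Phi). Qed.

Lemma gram_unit_basis A : gram A \in unitmx ->
  exists F, basis_of F [tuple row i A | i < k].
Proof.
rewrite (gram_unit_free Phi) => fr.
have d : \dim <<[tuple row i A | i < k]>> == k.
  by move: fr; rewrite /free size_tuple.
by exists (Grassmann km d) => /=; rewrite /basis_of eqxx fr.
Qed.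

Lemma basis_change F A B :
  basis_of F [tuple row i A | i < k] -> basis_of F [tuple row i B | i < k] ->
  exists g, B = g *m A.
Proof.
move=> bA bB; exists (\matrix_(i, j) coord [tuple row i A | i < k] j (row i B)).
apply/row_matrixP => i; rewrite row_mul mulmx_sum_row.
have rB : row i B \in <<[tuple row i A | i < k]>>%VS.
  rewrite (span_basis bA) -(span_basis bB); apply: memv_span.
  by apply/tnthP; exists i; rewrite tnth_mktuple.
rewrite [LHS](coord_span rB); apply: eq_bigr => j _; rewrite !mxE.
by rewrite -tnth_nth tnth_mktuple.
Qed.

Lemma gprojE F A : basis_of F [tuple row i A | i < k] -> gproj F = rowproj A.
Proof.
move=> bA; have bF := gbasisP F.
have [g gE] := basis_change bF bA; have [h hE] := basis_change bA bF.
by apply: (proj_row_space Phi _ _ gE hE);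
  [exact: basis_gram_unit bF|exact: basis_gram_unit bA].
Qed.

(** The orthogonal reflection through [F]. *)
Definition greflection F : 'M[K]_m := gproj F + gproj F - 1.

(** The sigma-algebra is generated by the quotient topology, whose open sets are
    seen through the matrices whose rows form a basis of the subspace. *)
Lemma measurable_grassmann (h : G -> R) (g : 'M[K]_(k, m) -> R) :
  (forall F A, basis_of F [tuple row i A | i < k] -> h F = g A) ->
  (forall A, gram A \in unitmx -> {for A, continuous g}) ->
  measurable_fun setT h.
Proof.
move=> hg cg; apply: (measurability _ (RGenOInfty.measurableE R)) => //.
move=> _ [_ [x ->] <-]; rewrite setTI; apply: sub_sigma_algebra.
rewrite /grassmann_open /= openE => A /= [F /= hF bF].
have uA := basis_gram_unit bF.
have gA : x < g A by rewrite -(hg F A bF); move: hF; rewrite in_itv /= andbT.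
have near_g : \forall B \near A, x < g B by exact: (cvgr_gt _ (cg A uA)).
have near_u := gram_unit_near Phi uA.
rewrite /interior; near=> B.
have uB : gram B \in unitmx by near: B.
have [F' bF'] := gram_unit_basis uB; exists F' => //=.
by rewrite in_itv /= andbT (hg F' B bF'); near: B.
Unshelve. all: by end_near. Qed.

Lemma gproj_measurable : mx_measurable Phi gproj.
Proof.
move=> i j; split; [apply: (measurable_grassmann (g := fun A => re Phi (rowproj A i j)))
  |apply: (measurable_grassmann (g := fun A => im Phi (rowproj A i j)))].
- by move=> F A /gprojE /= ->.
- move=> A uA; apply: (@continuous_cvg _ _ _ (nbhs A) (nbhs_filter A)).
    exact: re_continuous.
  exact: (proj_cvg Phi uA).
- by move=> F A /gprojE /= ->.
- move=> A uA; apply: (@continuous_cvg _ _ _ (nbhs A) (nbhs_filter A)).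
    exact: im_continuous.
  exact: (proj_cvg Phi uA).
Qed.

Lemma greflection_measurable : mx_measurable Phi greflection.
Proof.
apply: mx_measurableB; last exact: mx_measurable_cst.
by apply: mx_measurableD; exact: gproj_measurable.
Qed.

(** The default value [F] of [insubd] is only reached when the matrix is not
    invertible. *)
Definition gact (U : 'M[K]_m) F : G :=
  insubd F (linfun (mulmxr U) @: F)%VS.

Section Action.
Variable U : 'M[K]_m.
Hypothesis hU : is_isometry U.

Let lker0 : lker (linfun (mulmxr U : 'rV[K]_m -> 'rV[K]_m)) == 0%VS.
Proof.
apply/lker0P => u v; rewrite !lfunE /= => /(congr1 (mulmx^~ (dag U))).
by rewrite -!mulmxA hU !mulmx1.
Qed.

Lemma gactE F : gact U F = (linfun (mulmxr U) @: F)%VS :> {vspace _}.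
Proof.
rewrite /gact insubdK // -topredE /= limg_dim_eq ?gdim //.
by move/eqP: lker0 => ->; rewrite capv0.
Qed.

Lemma gact_basis F A : basis_of F [tuple row i A | i < k] ->
  basis_of (gact U F) [tuple row i (A *m U) | i < k].
Proof.
move=> bA; rewrite gactE.
rewrite (@rows_of _ (map (linfun (mulmxr U)) [tuple row i A | i < k])).
- by apply: limg_basis_of => //; move/eqP: lker0 => ->; rewrite capv0.
- by rewrite size_map size_tuple.
- move=> i; rewrite (nth_map 0) ?size_tuple //.
  by rewrite -tnth_nth tnth_mktuple lfunE /= row_mul.
Qed.

Lemma gact_proj F : gproj (gact U F) = dag U *m gproj F *m U.
Proof. by rewrite (gprojE (gact_basis (gbasisP F))) proj_mul. Qed.

Lemma gact_reflection F : greflection (gact U F) = dag U *m greflection F *m U.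
Proof.
rewrite /greflection gact_proj mulmxBr mulmxBl !mulmxDr !mulmxDl.
by rewrite mulmx1 (isometryV hU).
Qed.

End Action.

Lemma gactK U F : is_isometry U -> gact (dag U) (gact U F) = F.
Proof.
move=> hU; apply/val_inj; have hV := isometry_dag Phi hU.
rewrite /= !gactE // -limg_comp -[RHS]lim1g; apply/eq_in_limg => v _.
by rewrite comp_lfunE !lfunE /= -mulmxA hU mulmx1.
Qed.

Lemma gact_measurable U : is_isometry U -> measurable_fun setT (gact U).
Proof.
move=> hU; apply: (measurability (@grassmann_open _ K m k km)) => //.
move=> _ [V oV <-]; rewrite setTI; apply: sub_sigma_algebra.
rewrite /grassmann_open /=.
have -> : [set A : 'M[K]_(k, m) | exists2 E : G, (gact U @^-1` V) E &
      basis_of E [tuple row i A | i < k]] =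
    (fun A => A *m U) @^-1` [set A : 'M[K]_(k, m) | exists2 E : G, V E &
      basis_of E [tuple row i A | i < k]].
  apply/seteqP; split => A /= [E VE bE].
    by exists (gact U E) => //; exact: gact_basis.
  have hV := isometry_dag Phi hU.
  exists (gact (dag U) E).
    by have := gactK E hV; rewrite (dagK Phi) /= => ->.
  by have := gact_basis hV bE; rewrite -mulmxA hU mulmx1.
apply: open_comp oV => A _; have FA := nbhs_filter A.
apply: (@mx_cvg _ _ _ (nbhs A) FA); apply: (@mulmx_cvg _ _ _ (nbhs A) FA).
  by move=> i j; exact: coord_continuous.
by move=> i j; exact: cvg_cst.
Qed.

(** [is_haar] speaks of direct images; the preimage under the action of [U] is the
    direct image under the inverse of [U]. *)
Lemma haar_invariant (mu : {measure set G -> \bar R}) (U : 'M[K]_m) (A : set G) :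
  is_haar mu -> is_isometry U -> measurable A ->
  mu (gact U @^-1` A) = mu A.
Proof.
move=> [_ hmu] hU mA; have hV := isometry_dag Phi hU.
rewrite -(hmu _ hV A mA); congr (mu _); apply/seteqP; split => F /=.
  move=> AF; exists (gact U F) => //.
  by have := gactK F hU => /(congr1 (@gval _ _ _ _ _)) <-; rewrite [RHS]gactE.
move=> [E AE EF]; suff -> : F = gact (dag U) E.
  by have := gactK E hV; rewrite (dagK Phi) => ->.
by apply/val_inj; rewrite /= gactE.
Qed.

End GrassmannProjection.

Lemma greflection_symmetry (R : realType) (K : scalarField R)
    (Phi : scalar_parts K) n (F : grassmann K (leq_mul2n n)) :
  balanced_symmetry (greflection F).
Proof.
have u := basis_gram_unit Phi (gbasisP F).
have i : gproj F * gproj F = gproj F := proj_idem u.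
split.
- have QQ : (gproj F + gproj F) * (gproj F + gproj F)
      = (gproj F + gproj F) + (gproj F + gproj F).
    by rewrite mulrDl !mulrDr i.
  rewrite /greflection mulrBl mulrBr QQ mulr1 mul1r addrK.
  by rewrite opprB addrC subrK.
- by rewrite /greflection !dagD dagN (dag1 K) dag_proj.
- rewrite /greflection raddfB raddfD /= proj_tr // mxtrace1.
  by rewrite mul2n -addnn natrD subrr.
Qed.

(** * First order expansions *)

Section Expansion.
Context (R : realType) (K : scalarField R) (Phi : scalar_parts K) (X : Type).
Local Notation nrm := (nrm Phi).

(** [psi t x = phi x + t * D x + O(t ^ 2)] as [t] decreases to [0]. The constant
    does not depend on [x], so that the expansion may be integrated in [x] term
    by term. *)
Definition expands (psi : R -> X -> K) (phi D : X -> K) := exists C : R,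
  [/\ 0 <= C, forall x, nrm (phi x) <= C, forall x, nrm (D x) <= C &
    forall t x, 0 <= t <= 1 ->
      nrm (psi t x - phi x - sreal K t * D x) <= C * t ^+ 2].

Lemma expands_cst c : expands (fun _ _ => c) (fun=> c) (fun=> 0).
Proof.
exists (nrm c); split=> [|x|x|t x _]; rewrite ?nrm0 ?nrm_ge0 //.
by rewrite subrr mulr0 subr0 nrm0 mulr_ge0 ?nrm_ge0 ?sqr_ge0.
Qed.

Lemma expandsD p1 f1 d1 p2 f2 d2 : expands p1 f1 d1 -> expands p2 f2 d2 ->
  expands (fun t x => p1 t x + p2 t x) (fun x => f1 x + f2 x)
    (fun x => d1 x + d2 x).
Proof.
move=> [C1 [C10 hf1 hd1 hp1]] [C2 [C20 hf2 hd2 hp2]].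
exists (C1 + C2); split=> [|x|x|t x t01]; first exact: addr_ge0.
- by apply: (le_trans (nrmD _ _ _)); exact: lerD.
- by apply: (le_trans (nrmD _ _ _)); exact: lerD.
have -> : p1 t x + p2 t x - (f1 x + f2 x) - sreal K t * (d1 x + d2 x) =
  (p1 t x - f1 x - sreal K t * d1 x) + (p2 t x - f2 x - sreal K t * d2 x) by ring.
by apply: (le_trans (nrmD _ _ _)); rewrite mulrDl; apply: lerD; [exact: hp1|exact: hp2].
Qed.

(** The Leibniz rule: the errors of the factors are multiplied by bounded
    quantities, and the product of the two first order terms is itself [O(t ^ 2)]. *)
Lemma expandsM p1 f1 d1 p2 f2 d2 : expands p1 f1 d1 -> expands p2 f2 d2 ->
  expands (fun t x => p1 t x * p2 t x) (fun x => f1 x * f2 x)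
    (fun x => d1 x * f2 x + f1 x * d2 x).
Proof.
move=> [C1 [C10 hf1 hd1 hp1]] [C2 [C20 hf2 hd2 hp2]].
pose C := C1 + C2; have C0 : 0 <= C by exact: addr_ge0.
have le1 : C1 <= C by rewrite lerDl.
have le2 : C2 <= C by rewrite lerDr.
have bnd u v a b : nrm u <= a -> nrm v <= b -> nrm (u * v) <= a * b.
  by move=> ua vb; rewrite nrmM; apply: ler_pM => //; exact: nrm_ge0.
have {}hf1 x : nrm (f1 x) <= C by exact: le_trans le1.
have {}hd1 x : nrm (d1 x) <= C by exact: le_trans le1.
have {}hf2 x : nrm (f2 x) <= C by exact: le_trans le2.
have {}hd2 x : nrm (d2 x) <= C by exact: le_trans le2.
exists (6 * C ^+ 2); split=> [|x|x|t x t01].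
- by rewrite mulr_ge0 ?sqr_ge0.
- by apply: (le_trans (bnd _ _ _ _ (hf1 x) (hf2 x))); nra.
- apply: (le_trans (nrmD _ _ _)).
  have := bnd _ _ _ _ (hd1 x) (hf2 x); have := bnd _ _ _ _ (hf1 x) (hd2 x); nra.
have t0 : 0 <= t by lra.
have t1 : t <= 1 by lra.
have tt : 0 <= t ^+ 2 by exact: sqr_ge0.
have e1b : nrm (p1 t x - f1 x - sreal K t * d1 x) <= C * t ^+ 2.
  by apply: (le_trans (hp1 t x t01)); rewrite ler_wpM2r.
have e2b : nrm (p2 t x - f2 x - sreal K t * d2 x) <= C * t ^+ 2.
  by apply: (le_trans (hp2 t x t01)); rewrite ler_wpM2r.
have ntd d : nrm d <= C -> nrm (sreal K t * d) <= C * t.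
  by move=> dC; rewrite nrmM nrm_real ger0_norm // mulrC ler_wpM2r.
set e1 := p1 t x - _ - _ in e1b; set e2 := p2 t x - _ - _ in e2b.
have -> : p1 t x * p2 t x - f1 x * f2 x - sreal K t * (d1 x * f2 x + f1 x * d2 x)
  = (sreal K t * d1 x) * (sreal K t * d2 x)
    + (e1 * (f2 x + sreal K t * d2 x + e2) + (f1 x + sreal K t * d1 x) * e2).
  by rewrite /e1 /e2; ring.
have b1 := bnd _ _ _ _ (ntd _ (hd1 x)) (ntd _ (hd2 x)).
have lt1 a : 0 <= a -> a * t <= a by move=> a0; rewrite ler_piMr.
have Ct : C * t <= C by exact: lt1.
have Ctt : C * t ^+ 2 <= C by rewrite ler_piMr // exprn_ile1.
have b2 : nrm (f2 x + sreal K t * d2 x + e2) <= 3 * C.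
  apply: (le_trans (nrmD _ _ _)); have := nrmD Phi (f2 x) (sreal K t * d2 x).
  have := ntd _ (hd2 x); have := hf2 x; lra.
have b3 : nrm (f1 x + sreal K t * d1 x) <= 2 * C.
  have := nrmD Phi (f1 x) (sreal K t * d1 x).
  have := ntd _ (hd1 x); have := hf1 x; lra.
have b4 := bnd _ _ _ _ e1b b2; have b5 := bnd _ _ _ _ b3 e2b.
apply: (le_trans (nrmD _ _ _)).
have := nrmD Phi (e1 * (f2 x + sreal K t * d2 x + e2)) ((f1 x + sreal K t * d1 x) * e2).
have -> : 6 * C ^+ 2 * t ^+ 2 = C * t * (C * t) + (C * t ^+ 2 * (3 * C) + 2 * C * (C * t ^+ 2)) by ring.
lra.
Qed.

Lemma expands_sum (I : Type) (r : seq I) (p : I -> R -> X -> K) f d :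
  (forall i, expands (p i) (f i) (d i)) ->
  expands (fun t x => \sum_(i <- r) p i t x) (fun x => \sum_(i <- r) f i x)
    (fun x => \sum_(i <- r) d i x).
Proof.
move=> h; elim: r => [|i r ih].
  have -> : (fun t x => \sum_(i <- [::]) p i t x) = (fun _ _ => 0).
    by apply/funext => t; apply/funext => x; rewrite big_nil.
  have -> : (fun x => \sum_(i <- [::]) f i x) = (fun=> 0).
    by apply/funext => x; rewrite big_nil.
  have -> : (fun x => \sum_(i <- [::]) d i x) = (fun=> 0).
    by apply/funext => x; rewrite big_nil.
  exact: expands_cst.
have -> : (fun t x => \sum_(j <- i :: r) p j t x)
    = (fun t x => p i t x + \sum_(j <- r) p j t x).
  by apply/funext => t; apply/funext => x; rewrite big_cons.
have -> : (fun x => \sum_(j <- i :: r) f j x)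
    = (fun x => f i x + \sum_(j <- r) f j x).
  by apply/funext => x; rewrite big_cons.
have -> : (fun x => \sum_(j <- i :: r) d j x)
    = (fun x => d i x + \sum_(j <- r) d j x).
  by apply/funext => x; rewrite big_cons.
exact: expandsD.
Qed.

Definition mx_expands p q (psi : R -> X -> 'M[K]_(p, q)) (phi D : X -> 'M[K]_(p, q)) :=
  forall i j, expands (fun t x => psi t x i j) (fun x => phi x i j) (fun x => D x i j).

Lemma mx_expands_cst p q (A : 'M[K]_(p, q)) :
  mx_expands (fun _ _ => A) (fun=> A) (fun=> 0).
Proof.
move=> i j; have := expands_cst (A i j); congr expands.
by apply/funext => x; rewrite mxE.
Qed.

Lemma mx_expandsM p (p1 p2 : R -> X -> 'M[K]_p) f1 d1 f2 d2 :
  mx_expands p1 f1 d1 -> mx_expands p2 f2 d2 ->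
  mx_expands (fun t x => p1 t x * p2 t x) (fun x => f1 x * f2 x)
    (fun x => d1 x * f2 x + f1 x * d2 x).
Proof.
move=> h1 h2 i j.
have := @expands_sum _ (index_enum 'I_p) _ _ _ (fun l => expandsM (h1 i l) (h2 l j)).
congr expands.
- by apply/funext => t; apply/funext => x; rewrite mxE.
- by apply/funext => x; rewrite mxE.
- by apply/funext => x; rewrite !mxE big_split.
Qed.

Lemma expands_tr p (p1 : R -> X -> 'M[K]_p) f1 d1 : mx_expands p1 f1 d1 ->
  expands (fun t x => \tr (p1 t x)) (fun x => \tr (f1 x)) (fun x => \tr (d1 x)).
Proof. by move=> h; apply: expands_sum => i; exact: h. Qed.

End Expansion.

Section Rotation.
Context (R : realType) (K : scalarField R) (Phi : scalar_parts K) (m : nat).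

Definition rot_sin (t : R) : R := t / (1 + t ^+ 2 / 4).
Definition rot_versin (t : R) : R := t ^+ 2 / 2 / (1 + t ^+ 2 / 4).

(** A rational parametrisation of the rotations in the coordinate plane of [a]
    and [b], with velocity [plane_gen K a b] at the identity. Its shape
    [1 + sin X + (1 - cos) X ^ 2] comes from [X ^ 3 = - X]. *)
Definition rotation (a b : 'I_m) (t : R) : 'M[K]_m :=
  let X := plane_gen K a b in
  1%:M + sreal K (rot_sin t) *: X + sreal K (rot_versin t) *: (X *m X).

Lemma plane_gen_cube (a b : 'I_m) (X := plane_gen K a b) : X *m X *m X = - X.
Proof.
rewrite {}/X /plane_gen; have [->|ab] := eqVneq a b.
  by rewrite subrr !mulmx0 oppr0.
have ba : b != a by rewrite eq_sym.
have d1 (i : 'I_m) : delta_mx a b *m delta_mx a i = 0 :> 'M[K]_m by rewrite mul_delta_mx_0.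
have d2 (i : 'I_m) : delta_mx b a *m delta_mx b i = 0 :> 'M[K]_m by rewrite mul_delta_mx_0.
have d3 (i : 'I_m) : delta_mx a a *m delta_mx b i = 0 :> 'M[K]_m by rewrite mul_delta_mx_0.
have d4 (i : 'I_m) : delta_mx b b *m delta_mx a i = 0 :> 'M[K]_m by rewrite mul_delta_mx_0.
have X2 : (delta_mx a b - delta_mx b a) *m (delta_mx a b - delta_mx b a)
    = - (delta_mx a a + delta_mx b b) :> 'M[K]_m.
  by rewrite mulmxBl !mulmxBr d1 d2 !mul_delta_mx subr0 sub0r opprD addrC.
rewrite X2 mulNmx mulmxDl !mulmxBr !mul_delta_mx d3 d4 subr0 sub0r.
by [].
Qed.

Lemma dag_plane_gen (a b : 'I_m) : dag (plane_gen K a b) = - plane_gen K a b.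
Proof.
by apply/matrixP => i j; rewrite !mxE rmorphB !rmorph_nat opprB ![(i == _) && _]andbC.
Qed.

Lemma dagZ (r : R) (A : 'M[K]_m) : dag (sreal K r *: A) = sreal K r *: dag A.
Proof. by apply/matrixP => i j; rewrite !mxE rmorphM (sconj_real Phi). Qed.

Lemma plane_genN (a b : 'I_m) : plane_gen K b a = - plane_gen K a b.
Proof. by rewrite /plane_gen opprB. Qed.

Lemma dag_rotation a b t : dag (rotation a b t) = rotation b a t.
Proof.
rewrite /rotation /= !dagD !dagZ (dag1 K) dagM !dag_plane_gen (plane_genN a b).
by [].
Qed.

Lemma rotation_isometry a b t : is_isometry (rotation a b t).
Proof.
rewrite /is_isometry -/(dag _) dag_rotation /rotation /= (plane_genN a b).
have := plane_gen_cube a b; move: (plane_gen K a b) => X X3.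
rewrite mulmxN mulNmx opprK scalerN.
set s := sreal K (rot_sin t); set v := sreal K (rot_versin t).
have sv : s * s = v + v - v * v.
  have e : rot_sin t * rot_sin t = rot_versin t + rot_versin t - rot_versin t * rot_versin t.
    rewrite /rot_sin /rot_versin; field.
    by apply: lt0r_neq0; have := sqr_ge0 t; nra.
  by rewrite /s /v -!rmorphM e rmorphB rmorphD.
have X3' : X *m (X *m X) = - X by rewrite mulmxA.
have X4 : X *m X *m (X *m X) = - (X *m X) by rewrite mulmxA X3 mulNmx.
rewrite !(mulmxDl, mulmxDr, mulmxN) !mul1mx !mulmx1 -!scalemxAl -!scalemxAr.
rewrite X3 X3' X4 !scalerA sv.
move: (X *m X) => Y; apply/matrixP => i j; rewrite !mxE.
ring.
Qed.

Lemma rot_param t : 0 <= t <= 1 ->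
  `|rot_sin t - t| <= t ^+ 2 /\ `|rot_versin t| <= t ^+ 2.
Proof.
move=> /andP[t0 t1]; have tt : 0 <= t ^+ 2 by exact: sqr_ge0.
have u0 : 0 <= t ^+ 2 / 4 by lra.
have d0 : 0 < 1 + t ^+ 2 / 4 by lra.
split.
  have -> : rot_sin t - t = - (t ^+ 2 / 4 * rot_sin t).
    by rewrite /rot_sin; field; apply: lt0r_neq0; nra.
  have s0 : 0 <= rot_sin t by rewrite divr_ge0 // ltW.
  have s1 : rot_sin t <= 1 by rewrite ler_pdivrMr //; lra.
  rewrite normrN ger0_norm; last by rewrite mulr_ge0.
  have : t ^+ 2 / 4 * rot_sin t <= t ^+ 2 / 4 * 1 by rewrite ler_wpM2l.
  lra.
have v0 : 0 <= rot_versin t by rewrite !divr_ge0 // ltW.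
rewrite ger0_norm // ler_pdivrMr //; nra.
Qed.

Context (Y : Type).

Lemma rotation_expands a b :
  mx_expands Phi (fun t (_ : Y) => rotation a b t) (fun=> 1) (fun=> plane_gen K a b).
Proof.
move=> i j; set X := plane_gen K a b.
pose C := 1 + nrm Phi (X i j) + nrm Phi ((X *m X) i j).
have x0 := nrm_ge0 Phi (X i j); have xx0 := nrm_ge0 Phi ((X *m X) i j).
exists C; split => [|_|_|t _ t01].
- by rewrite !addr_ge0.
- have n1 : nrm Phi ((1 : 'M[K]_m) i j) <= 1.
    by rewrite mxE; case: eqP => _; rewrite ?nrm1 ?nrm0.
  by apply: (le_trans n1); rewrite /C; lra.
- by rewrite /C; lra.
have [hs hv] := rot_param t01.
have -> : rotation a b t i j - (1 : 'M[K]_m) i j - sreal K t * X i j =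
    sreal K (rot_sin t - t) * X i j + sreal K (rot_versin t) * (X *m X) i j.
  rewrite /rotation -/X !mxE rmorphB /=; ring.
apply: (le_trans (nrmD _ _ _)); rewrite !nrmM !nrm_real.
have tt : 0 <= t ^+ 2 by exact: sqr_ge0.
by rewrite /C; nra.
Qed.

End Rotation.

(** * The loop equation in mean *)

Section BoundedExpectation.
Context (R : realType) (d : measure_display) (X : measurableType d).
Implicit Types f g : X -> R.

Definition bounded_measurable f :=
  measurable_fun setT f /\ exists C, forall x, `|f x| <= C.

Lemma bounded_measurable_cst c : bounded_measurable (fun=> c).
Proof. by split; [exact: measurable_cst|exists `|c|]. Qed.

Lemma bounded_measurableD f g : bounded_measurable f -> bounded_measurable g ->
  bounded_measurable (fun x => f x + g x).
Proof.
move=> [mf [C fC]] [mg [D gD]]; split; first exact: measurable_funD.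
by exists (C + D) => x; apply: (le_trans (ler_normD _ _)); exact: lerD.
Qed.

Lemma bounded_measurableM f g : bounded_measurable f -> bounded_measurable g ->
  bounded_measurable (fun x => f x * g x).
Proof.
move=> [mf [C fC]] [mg [D gD]]; split; first exact: measurable_funM.
by exists (C * D) => x; rewrite normrM; exact: ler_pM.
Qed.

Lemma bounded_measurableZ c f : bounded_measurable f ->
  bounded_measurable (fun x => c * f x).
Proof. by move=> hf; apply: bounded_measurableM => //; exact: bounded_measurable_cst. Qed.

Lemma bounded_measurable_norm f : bounded_measurable f ->
  bounded_measurable (fun x => `|f x|).
Proof.
move=> [mf [C fC]]; split; first exact: measurableT_comp.
by exists C => x; rewrite normr_id.
Qed.

Lemma bounded_measurable_sum (I : Type) (r : seq I) (F : I -> X -> R) :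
  (forall i, bounded_measurable (F i)) ->
  bounded_measurable (fun x => \sum_(i <- r) F i x).
Proof.
move=> h; elim: r => [|i r ih].
  by under eq_fun do rewrite big_nil; exact: bounded_measurable_cst.
by under eq_fun do rewrite big_cons; exact: bounded_measurableD.
Qed.

Context (P : probability X R).
Local Notation Ex f := (\int[P]_x f x).

Lemma bounded_measurable_integrable f : bounded_measurable f ->
  P.-integrable setT (EFin \o f).
Proof.
move=> [mf [C fC]]; apply: measurable_bounded_integrable => //.
  exact: (le_lt_trans (probability_le1 P measurableT) (ltry 1)).
exists C; split; first exact: num_real.
by move=> M CM x _; apply: (le_trans (fC x)); exact: ltW.
Qed.

Lemma expectD f g : bounded_measurable f -> bounded_measurable g ->
  Ex (fun x => f x + g x) = Ex f + Ex g.
Proof.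
by move=> hf hg; rewrite RintegralD //; exact: bounded_measurable_integrable.
Qed.

Lemma expectZ c f : bounded_measurable f -> Ex (fun x => c * f x) = c * Ex f.
Proof. by move=> hf; rewrite RintegralZl //; exact: bounded_measurable_integrable. Qed.

Lemma expect_cst c : \int[P]_x c = c.
Proof. by rewrite Rintegral_cst // (congr1 fine (probability_setT P)) mulr1. Qed.

Lemma expect_sum (I : Type) (r : seq I) (F : I -> X -> R) :
  (forall i, bounded_measurable (F i)) ->
  Ex (fun x => \sum_(i <- r) F i x) = \sum_(i <- r) Ex (F i).
Proof.
move=> h; elim: r => [|i r ih].
  by under eq_Rintegral do rewrite big_nil; rewrite big_nil expect_cst.
under eq_Rintegral do rewrite big_cons.
by rewrite big_cons expectD ?ih //; exact: bounded_measurable_sum.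
Qed.

Lemma le_expect f g : bounded_measurable f -> bounded_measurable g ->
  (forall x, f x <= g x) -> Ex f <= Ex g.
Proof.
by move=> hf hg h; apply: le_Rintegral => //; exact: bounded_measurable_integrable.
Qed.

Lemma expect_invariant (h : X -> X) f : measurable_fun setT h ->
  (forall A, measurable A -> P (h @^-1` A) = P A) ->
  bounded_measurable f -> Ex (f \o h) = Ex f.
Proof.
move=> mh hP hf; have [mf _] := hf; rewrite /Rintegral; congr fine.
have hfh : bounded_measurable (f \o h).
  split; first exact: measurableT_comp.
  by case: hf => _ [C fC]; exists C => x; exact: fC.
have mEf : measurable_fun setT (EFin \o f) by exact/measurable_EFinP.
have E := integral_pushforward mh mEf (bounded_measurable_integrable hfh) measurableT.
apply: (etrans (esym E)).
by apply: eq_measure_integral => A mA _; exact: hP.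
Qed.

End BoundedExpectation.

Section LoopEquation.
Context (R : realType) (K : scalarField R) (Phi : scalar_parts K) (n : nat).
Local Notation G := (grassmann K (leq_mul2n n)).
Local Notation m := (2 * n)%N.
Variables (S : 'M[K]_m) (nu : probability G R).
Hypotheses (hS : balanced_symmetry S) (hnu : is_haar nu).
Let W (F : G) : 'M[K]_m := greflection F * S.

Let W_measurable k : mx_measurable Phi (fun F => W F ^+ k).
Proof.
apply: mx_measurableX; apply: mx_measurable_mul.
  exact: greflection_measurable.
exact: mx_measurable_cst.
Qed.

(** The Leibniz rule along [k] letters: the reflection moves to
    [U^* T U], whose derivative is [T * X - X * T], and [S] is constant. *)
Lemma word_expands (a b : 'I_m) k :
  mx_expands Phi (fun t F => W (gact (rotation K a b t) F) ^+ k) (fun F => W F ^+ k)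
    (fun F => dword S (greflection F) k (plane_gen K a b)).
Proof.
have expT : mx_expands Phi (fun t F => greflection (gact (rotation K a b t) F))
    (@greflection R K m n (leq_mul2n n))
    (fun F => dsym (greflection F) (plane_gen K a b)).
  have cT : mx_expands Phi (fun (_ : R) F => greflection F)
      (@greflection R K m n (leq_mul2n n)) (fun=> 0).
    move=> i j; exists 1; split=> // [F|F|t F _].
    - exact/isometry_entry/symmetry_isometry/(greflection_symmetry Phi).
    - by rewrite mxE nrm0.
    - by rewrite subrr [X in sreal K t * X]mxE mulr0 subr0 nrm0 mul1r sqr_ge0.
  have rba := @rotation_expands _ _ Phi _ G b a.
  have rab := @rotation_expands _ _ Phi _ G a b.
  have := mx_expandsM (mx_expandsM rba cT) rab.
  have -> : (fun t (x : G) => rotation K b a t * greflection x * rotation K a b t)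
      = (fun t (F : G) => greflection (gact (rotation K a b t) F)).
    apply/funext => t; apply/funext => F.
    have hU := rotation_isometry Phi a b t.
    by rewrite (gact_reflection Phi hU) dag_rotation.
  have -> : (fun x : G => 1 * greflection x * 1) = @greflection R K m n (leq_mul2n n).
    by apply/funext => F; rewrite mul1r mulr1.
  suff -> : (fun x : G => (plane_gen K b a * greflection x + 1 * 0) * 1
       + 1 * greflection x * plane_gen K a b)
     = (fun F : G => dsym (greflection F) (plane_gen K a b)) by [].
  apply/funext => F; rewrite /dsym mulr0 addr0 mulr1 mul1r.
  by rewrite (plane_genN K a b) mulNr addrC.
have cS : mx_expands Phi (fun (_ : R) (_ : G) => S) (fun=> S) (fun=> 0).
  exact: mx_expands_cst.
have expW := mx_expandsM expT cS.
elim: k => [|k ih].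
  have := @mx_expands_cst _ _ Phi G _ _ (1 : 'M[K]_m); congr mx_expands.
  by apply/funext => F; rewrite /dword big_ord0.
have := mx_expandsM ih expW; congr mx_expands.
- by apply/funext => t; apply/funext => F; rewrite exprSr.
- by apply/funext => F; rewrite exprSr.
apply/funext => F; rewrite mulr0 addr0 /dword big_ord_recr /= subnn expr0 mulr1.
congr (_ + _); rewrite mulr_suml; apply: eq_bigr => j _.
by rewrite -mulrA -exprSr -subSn.
Qed.

Lemma nrm_bounded_measurable (f : G -> K) : kmeasurable Phi f ->
  (exists C, forall F, nrm Phi (f F) <= C) -> bounded_measurable (re Phi \o f).
Proof.
move=> [mf _] [C fC]; split => //; exists C => F.
exact: le_trans (le_re_nrm _ _) (fC F).
Qed.

(** By invariance [f] has the same mean as its rotated copy, so that [t] times the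
    mean of [D] is [O(t ^ 2)] for all small [t]. *)
Lemma expect_derivative_eq0 (a b : 'I_m) (f D : G -> K) :
  kmeasurable Phi f -> kmeasurable Phi D ->
  expands Phi (fun t F => f (gact (rotation K a b t) F)) f D ->
  \int[nu]_F re Phi (D F) = 0.
Proof.
move=> mf mD [C [C0 fC DC hC]].
have bf : bounded_measurable (re Phi \o f).
  by apply: nrm_bounded_measurable => //; exists C.
have bD : bounded_measurable (re Phi \o D).
  by apply: nrm_bounded_measurable => //; exists C.
have key t : 0 < t <= 1 -> `|\int[nu]_F re Phi (D F)| <= C * t.
  move=> /andP[t0 t1]; set U := rotation K a b t.
  have hU : is_isometry U := rotation_isometry Phi a b t.
  have mU := gact_measurable Phi hU.
  have bfU : bounded_measurable ((re Phi \o f) \o gact U).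
    split; first by apply: measurableT_comp => //; case: bf.
    by case: bf => _ [E fE]; exists E => F; exact: fE.
  have inv : \int[nu]_F ((re Phi \o f) \o gact U) F = \int[nu]_F (re Phi \o f) F.
    apply: expect_invariant => // A mA.
    exact: (haar_invariant Phi hnu hU mA).
  pose g F := ((re Phi \o f) \o gact U) F + (- 1) * (re Phi \o f) F
     + (- t) * (re Phi \o D) F.
  have b1 : bounded_measurable (fun F => (- 1) * (re Phi \o f) F).
    exact: bounded_measurableZ.
  have b2 : bounded_measurable (fun F => (- t) * (re Phi \o D) F).
    exact: bounded_measurableZ.
  have b3 : bounded_measurable (fun F => ((re Phi \o f) \o gact U) F + (- 1) * (re Phi \o f) F).
    exact: bounded_measurableD.
  have bg : bounded_measurable g by exact: bounded_measurableD.
  have Eg : \int[nu]_F g F = - t * \int[nu]_F re Phi (D F).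
    rewrite /g expectD // expectD // !expectZ // inv.
    by rewrite mulN1r subrr add0r.
  have gb F : `|g F| <= C * t ^+ 2.
    have -> : g F = re Phi (f (gact U F) - f F - sreal K t * D F).
      by rewrite !raddfB /= reMreal /g /=; ring.
    apply: (le_trans (le_re_nrm _ _)); apply: hC.
    by rewrite (ltW t0).
  have gE : `|\int[nu]_F g F| <= C * t ^+ 2.
    rewrite ler_norml; apply/andP; split.
      rewrite -[leLHS](expect_cst nu); apply: le_expect => //.
        exact: bounded_measurable_cst.
      by move=> F; have := gb F; rewrite ler_norml => /andP[].
    rewrite -[leRHS](expect_cst nu); apply: le_expect => //.
      exact: bounded_measurable_cst.
    by move=> F; have := gb F; rewrite ler_norml => /andP[].
  move: gE; rewrite Eg normrM normrN (gtr0_norm t0) => h.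
  by rewrite -(ler_pM2l t0); apply: (le_trans h); nra.
apply/normr0_eq0/eqP; rewrite eq_le normr_ge0 andbT.
rewrite leNgt; apply/negP => h0; set e := `|_| in h0 key.
have D0 : 0 < C + e + 1 by lra.
have := key (e / (2 * (C + e + 1))).
rewrite divr_gt0 //=; last by lra.
rewrite ler_pdivrMr; last by lra.
rewrite mul1r => /(_ ltac:(lra)); rewrite mulrA ler_pdivlMr; last by lra.
nra.
Qed.

Lemma dmoment_measurable k (a b : 'I_m) :
  kmeasurable Phi (fun F : G => dmoment S (greflection F) k a b).
Proof.
have mT : mx_measurable Phi (@greflection R K m n (leq_mul2n n)).
  exact: greflection_measurable.
have mcst (A : 'M[K]_m) : mx_measurable Phi (fun _ : G => A) by exact: mx_measurable_cst.
have md : mx_measurable Phi (fun F : G => dword S (greflection F) k (plane_gen K a b)).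
  rewrite /dword; apply: mx_measurable_sum => j.
  apply: mx_measurable_mul; last exact: (W_measurable _).
  apply: mx_measurable_mul; first exact: (W_measurable _).
  apply: mx_measurable_mul => //; rewrite /dsym.
  by apply: mx_measurableB; apply: mx_measurable_mul.
apply: kmeasurableD; apply: kmeasurableM.
- exact: md.
- exact: kmeasurable_tr (W_measurable k).
- exact: (W_measurable k).
- exact: kmeasurable_tr.
Qed.

Lemma expect_dmoment k (a b : 'I_m) :
  \int[nu]_(F in [set: G]) re Phi (dmoment S (greflection F) k a b) = 0.
Proof.
apply: (@expect_derivative_eq0 a b (fun F : G => (W F ^+ k) a b * \tr (W F ^+ k))).
- by apply: kmeasurableM; [exact: (W_measurable k)|exact: kmeasurable_tr (W_measurable k)].
- exact: dmoment_measurable.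
- exact: expandsM (word_expands a b k a b) (expands_tr (word_expands a b k)).
Qed.

Lemma dmoment_bounded k (a b : 'I_m) :
  bounded_measurable (fun F : G => re Phi (dmoment S (greflection F) k a b)).
Proof.
apply: (nrm_bounded_measurable (dmoment_measurable k a b)).
have [C [_ _ hC _]] := expandsM (word_expands a b k a b) (expands_tr (word_expands a b k)).
by exists C.
Qed.

Lemma moment_bounded_measurable k :
  bounded_measurable (fun F : G => moment Phi S (greflection F) k).
Proof.
split.
  rewrite /moment; apply: measurable_funM; last exact: measurable_cst.
  by have [] := kmeasurable_tr (W_measurable k).
by exists 1 => F; apply: moment_le1 => //; exact: (greflection_symmetry Phi).
Qed.

(** The derivatives in [loop_inequality] have mean zero. *)
Lemma expect_moment_sqr k : (0 < n)%N -> (0 < k)%N ->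
  \int[nu]_(F in [set: G]) (moment Phi S (greflection F) k ^+ 2) <=
    \sum_(1 <= j < k) \int[nu]_(F in [set: G]) `|moment Phi S (greflection F) j|
      + 6 * k%:R / m%:R.
Proof.
move=> n0 k0; have m0 : (0 < m)%N by rewrite muln_gt0.
have bs : bounded_measurable
    (fun F : G => \sum_a \sum_b re Phi (dmoment S (greflection F) k a b)).
  by apply: bounded_measurable_sum => a; apply: bounded_measurable_sum => b; exact: dmoment_bounded.
have bn : bounded_measurable
    (fun F : G => \sum_(1 <= j < k) `|moment Phi S (greflection F) j|).
  apply: bounded_measurable_sum => j; apply: bounded_measurable_norm.
  exact: moment_bounded_measurable.
pose c : R := - (m%:R ^+ 3)^-1.
have bcs : bounded_measurable
    (fun F : G => c * \sum_a \sum_b re Phi (dmoment S (greflection F) k a b)).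
  exact: bounded_measurableZ.
have bcsn := bounded_measurableD bcs bn.
have bk := bounded_measurable_cst G (6 * k%:R / m%:R : R).
apply: (@le_trans _ _ (\int[nu]_(F in [set: G]) (c * (\sum_a \sum_b re Phi (dmoment S (greflection F) k a b))
    + \sum_(1 <= j < k) `|moment Phi S (greflection F) j| + 6 * k%:R / m%:R))).
  apply: le_expect.
  - under eq_fun do rewrite expr2.
    by apply: bounded_measurableM; exact: moment_bounded_measurable.
  - exact: bounded_measurableD.
  move=> F; have := loop_inequality Phi hS (greflection_symmetry Phi F) m0 k0.
  by rewrite /c mulNr mulrC mulNr.
rewrite expectD // expectD // expectZ // expect_cst.
rewrite expect_sum; last first.
  by move=> a; apply: bounded_measurable_sum => b; exact: dmoment_bounded.
rewrite big1; last first.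
  move=> a _; rewrite expect_sum; last by move=> b; exact: dmoment_bounded.
  by rewrite big1 // => b _; exact: expect_dmoment.
rewrite mulr0 add0r expect_sum //.
by move=> j; apply: bounded_measurable_norm; exact: moment_bounded_measurable.
Qed.

End LoopEquation.

Section MomentDecay.
Context (R : realType) (K : scalarField R) (Phi : scalar_parts K).

(** By strong induction on [k], the moments of lower order being small in mean
    since [`|x| <= dl + x ^+ 2 / dl]. The rank [N] does not depend on [S], so that
    the estimate may be averaged over an independent random [S]. *)
Lemma moment_sqr_cvg0 (k : nat) (e : R) : (0 < k)%N -> 0 < e ->
  exists N : nat, forall n : nat, (N <= n)%N ->
  forall (S : 'M[K]_(2 * n)) (nu : probability (grassmann K (leq_mul2n n)) R),
    balanced_symmetry S -> is_haar nu ->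
    \int[nu]_F (moment Phi S (greflection F) k ^+ 2) <= e.
Proof.
elim/ltn_ind: k e => k ih e k0 e0.
have k0' : 0 < k%:R :> R by rewrite ltr0n.
pose dl : R := e / (4 * k%:R).
have dl0 : 0 < dl by rewrite divr_gt0 // mulr_gt0.
have /boolp.choice[N hN] : forall j : 'I_k, exists N : nat, (0 < j)%N ->
    forall n : nat, (N <= n)%N ->
    forall (S : 'M[K]_(2 * n)) (nu : probability (grassmann K (leq_mul2n n)) R),
    balanced_symmetry S -> is_haar nu ->
    \int[nu]_F (moment Phi S (greflection F) j ^+ 2) <= dl * dl.
  move=> j; have [j0|] := posnP j; first by exists 0%N.
  by move=> j0; have [N hN] := ih j (ltn_ord j) (dl * dl) j0 (mulr_gt0 dl0 dl0); exists N.
pose N0 := (\max_j N j)%N.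
pose N1 := Num.Def.archi_bound (6 * k%:R / e).
exists (maxn N0 N1.+1) => n; rewrite geq_max => /andP[n0 n1] S nu hS hnu.
have npos : (0 < n)%N by exact: leq_ltn_trans n1.
apply: (le_trans (expect_moment_sqr Phi hS hnu npos k0)).
have b1 (j : nat) : (0 < j < k)%N ->
    \int[nu]_F `|moment Phi S (greflection F) j| <= 2 * dl.
  move=> /andP[j0 jk].
  have bm := moment_bounded_measurable Phi hS j.
  have bm2 : bounded_measurable (fun F : grassmann K (leq_mul2n n) =>
      moment Phi S (greflection F) j ^+ 2).
    by under eq_fun do rewrite expr2; exact: bounded_measurableM.
  have bm3 : bounded_measurable (fun F : grassmann K (leq_mul2n n) =>
      dl^-1 * moment Phi S (greflection F) j ^+ 2) by exact: bounded_measurableZ.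
  have bd := bounded_measurable_cst (grassmann K (leq_mul2n n)) dl.
  apply: (@le_trans _ _ (\int[nu]_F (dl + dl^-1 * moment Phi S (greflection F) j ^+ 2))).
    apply: le_expect; [exact: bounded_measurable_norm|exact: bounded_measurableD|].
    move=> F; set x := moment _ _ _ _.
    rewrite -(ler_pM2l dl0) mulrDr mulVKf ?gt_eqF // -real_normK ?num_real //.
    by have := sqr_ge0 (`|x| - dl); have := normr_ge0 x; nra.
  rewrite expectD // expect_cst expectZ //.
  have := hN (Ordinal jk) j0 n (leq_trans (leq_bigmax _) n0) S nu hS hnu => /= h.
  have : dl^-1 * \int[nu]_F (moment Phi S (greflection F) j ^+ 2) <= dl.
    by rewrite mulrC ler_pdivrMr.
  lra.
have b2 : \sum_(1 <= j < k) \int[nu]_F `|moment Phi S (greflection F) j| <= e / 2.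
  apply: (@le_trans _ _ (\sum_(1 <= j < k) 2 * dl)).
    by rewrite big_nat_cond [leRHS]big_nat_cond; apply: ler_sum => j; rewrite andbT; exact: b1.
  rewrite sumr_const_nat -[leLHS]mulr_natr.
  have -> : e / 2 = 2 * dl * k%:R by rewrite /dl; field; rewrite gt_eqF.
  by rewrite ler_wpM2l ?ler_nat ?leq_subr // mulr_ge0 // ltW.
have b3 : 6 * k%:R / (2 * n)%:R <= e / 2.
  have n0' : 0 < n%:R :> R by rewrite ltr0n.
  have : 6 * k%:R / e <= n%:R.
    apply: ltW; apply: (lt_le_trans (archi_boundP _)).
      by rewrite divr_ge0 ?mulr_ge0 // ltW.
    by rewrite ler_nat ltnW.
  rewrite ler_pdivrMr // => h.
  by rewrite natrM ler_pdivrMr ?mulr_gt0 //; nra.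
lra.
Qed.

End MomentDecay.

(** * Traces in terms of the principal angles *)

Section PrincipalAngles.
Context (R : realType) (K : scalarField R) (Phi : scalar_parts K) (n : nat).
Local Notation G := (grassmann K (leq_mul2n n)).
Local Notation m := (2 * n)%N.

Lemma orthonormal_rows (E : G) (e : (\dim E).-tuple 'rV[K]_m)
    (A : 'M[K]_(n, m) := \matrix_(i < n) e`_i) : orthonormal_basis E e ->
  gproj E = dag A *m A /\ gram A = 1%:M.
Proof.
move=> [bE oE]; have dE := gdim E.
have rowsA : [tuple row i A | i < n] = e :> seq _.
  by apply: rows_of => [|i]; rewrite ?size_tuple // rowK.
have gA : gram A = 1%:M.
  apply/matrixP => i j; rewrite !mxE.
  pose i' := cast_ord (esym dE) i; pose j' := cast_ord (esym dE) j.
  have := oE i' j'; rewrite (inj_eq (@cast_ord_inj _ _ _)) => <-.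
  by apply: eq_bigr => l _; rewrite !mxE !(tnth_nth 0).
have bA : basis_of E [tuple row i A | i < n] by rewrite rowsA.
by rewrite (gprojE Phi bA) proj_orthonormal.
Qed.

Variables (E F : G) (theta : n.-tuple R).
Let S := greflection E.
Let T := greflection F.
Let hS : balanced_symmetry S := greflection_symmetry Phi E.
Let hT : balanced_symmetry T := greflection_symmetry Phi F.

Let dg (g : R -> R) : 'M[K]_n := diag_mx (\row_(i < n) sreal K (g theta`_i)).

Let dgM g h : dg g *m dg h = dg (fun x => g x * h x).
Proof.
rewrite /dg mulmx_diag; congr diag_mx; apply/rowP => i; rewrite !mxE.
by rewrite -rmorphM.
Qed.

Let dgB g h : dg g - dg h = dg (fun x => g x - h x).
Proof.
rewrite /dg -raddfB /=; congr diag_mx; apply/rowP => i; rewrite !mxE.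
by rewrite -rmorphB.
Qed.

Let dgD g h : dg g + dg h = dg (fun x => g x + h x).
Proof.
rewrite /dg -raddfD /=; congr diag_mx; apply/rowP => i; rewrite !mxE.
by rewrite -rmorphD.
Qed.

Let dg1 : dg (fun=> 1) = 1%:M.
Proof. by apply/matrixP => i j; rewrite !mxE rmorph1. Qed.

Section Basis.
Variables A B : 'M[K]_(n, m).
Hypotheses (pE : gproj E = dag A *m A) (pF : gproj F = dag B *m B).
Hypotheses (gA : gram A = 1%:M) (hAB : A *m dag B = dg (@cos R)).

Let V k : 'M[K]_m := (T * S) ^+ k + (S * T) ^+ k.

(** Writing [P] and [Q] for the projections onto [E] and [F], the product
    [A *m Q] is [cos Theta *m B] and [B *m P] is [cos Theta *m A]; expanding the
    reflections leaves [4 cos ^ 2 - 2 = 2 cos (2 theta)] on the rows of [A]. *)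
Lemma chebyshev_step : A *m V 1 = dg (fun x => cos (2 * x) + cos (2 * x)) *m A.
Proof.
have hBA : B *m dag A = dg (@cos R).
  rewrite -[LHS](dagK Phi) dagM (dagK Phi) hAB; apply/matrixP => i j.
  rewrite dagE !mxE [j == i]eq_sym; case: eqVneq => [->|_].
    by rewrite !mulr1n (sconj_real Phi).
  by rewrite !mulr0n rmorph0.
have AS : A *m S = A.
  by rewrite /S /greflection pE mulmxBr mulmxDr mulmxA -/(gram A) gA mul1mx mulmx1 addrK.
have AT : A *m T = dg (@cos R) *m B + dg (@cos R) *m B - A.
  by rewrite /T /greflection pF mulmxBr mulmxDr !mulmxA hAB mulmx1.
have BS : B *m S = dg (@cos R) *m A + dg (@cos R) *m A - B.
  by rewrite /S /greflection pE mulmxBr mulmxDr !mulmxA hBA mulmx1.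
rewrite /V !expr1 mulmxDr -!mulmxE [A *m (T *m S)]mulmxA [A *m (S *m T)]mulmxA.
rewrite AS AT mulmxBl mulmxDl AS -!mulmxA BS !mulmxDr !mulmxN !mulmxA dgM.
have -> : dg (fun x => cos (2 * x) + cos (2 * x)) =
    dg (fun x => cos x * cos x) + dg (fun x => cos x * cos x)
    + (dg (fun x => cos x * cos x) + dg (fun x => cos x * cos x)) - 1%:M - 1%:M.
  rewrite -dg1 !(dgD, dgB); congr dg; apply/funext => x.
  by rewrite mulr_natl cosD -[sin x * sin x]expr2 sin2cos2; ring.
rewrite !mulmxBl !mulmxDl mul1mx.
move: (dg (fun x => cos x * cos x) *m A) (dg (@cos R) *m B) => X Y.
by apply/matrixP => i j; rewrite !mxE; ring.
Qed.

(** [V k] is invariant under exchanging [S] and [T], hence commutes with both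
    and preserves the row space of [A]. There it acts by [2 cos (2 k theta)], as
    [V] and the cosines obey the same three-term recurrence. *)
Lemma chebyshev k :
  A *m V k = dg (fun x => cos (k%:R * (2 * x)) + cos (k%:R * (2 * x))) *m A.
Proof.
have VV j : V j.+2 = V 1 * V j.+1 - V j.
  have TS : (T * S) * (S * T) = 1.
    by rewrite mulrA -(mulrA T) (let: And3 h _ _ := hS in h) mulr1 (let: And3 h _ _ := hT in h).
  have ST : (S * T) * (T * S) = 1.
    by rewrite mulrA -(mulrA S) (let: And3 h _ _ := hT in h) mulr1 (let: And3 h _ _ := hS in h).
  have h1 : (T * S) * (S * T) ^+ j.+1 = (S * T) ^+ j by rewrite exprS mulrA TS mul1r.
  have h2 : (S * T) * (T * S) ^+ j.+1 = (T * S) ^+ j by rewrite exprS mulrA ST mul1r.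
  rewrite /V !expr1; move: (T * S) (S * T) h1 h2 => X Y h1 h2.
  rewrite mulrDl !mulrDr h1 h2 -!exprS.
  by apply/matrixP => a b; rewrite !mxE; ring.
elim/ltn_ind: k => -[_|[_|k ih]].
- rewrite /V !expr0 mulmxDr mulmx1.
  have -> : dg (fun x => cos (0%:R * (2 * x)) + cos (0%:R * (2 * x))) = 1%:M + 1%:M.
    by rewrite -dg1 dgD; congr dg; apply/funext => x; rewrite mul0r cos0.
  by rewrite mulmxDl mul1mx.
- rewrite chebyshev_step; congr (dg _ *m _).
  by apply/funext => x; rewrite mul1r.
rewrite VV mulmxBr -mulmxE mulmxA chebyshev_step -mulmxA ih // ih //.
rewrite mulmxA dgM -mulmxBl dgB; congr (dg _ *m _); apply/funext => x.
set y := 2 * x.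
have -> : k.+2%:R * y = k.+1%:R * y + y by rewrite -[k.+2]addn1 natrD mulrDl mul1r.
have -> : k%:R * y = k.+1%:R * y - y by rewrite -[k.+1]addn1 natrD mulrDl mul1r addrK.
by rewrite cosB cosD; ring.
Qed.

(** Half of the trace of [V k] is carried by [E], since the trace of [V k * S]
    is that of odd words. *)
Lemma word_tr_angles k :
  \tr ((T * S) ^+ k) = sreal K (2 * \sum_(i < n) cos (k%:R * (2 * theta`_i))).
Proof.
have trVS : \tr (V k * S) = 0.
  rewrite /V mulrDl mxtraceD (odd_word_tr hS hT k).2.
  by rewrite (odd_word_tr hT hS k).1 addr0.
have trV : \tr (V k) = \tr ((T * S) ^+ k) + \tr ((T * S) ^+ k).
  by rewrite /V mxtraceD word_tr_dag.
have trVP : \tr (V k *m gproj E) =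
    \tr (dg (fun x => cos (k%:R * (2 * x)) + cos (k%:R * (2 * x)))).
  rewrite pE mulmxA mxtrace_mulC mulmxA chebyshev -mulmxA -/(gram A) gA.
  by rewrite mulmx1.
have e : \tr (V k) = \tr (V k *m gproj E) + \tr (V k *m gproj E) - \tr (V k * S).
  rewrite -mxtraceD -raddfB /=; congr (\tr _).
  by rewrite /S /greflection -mulmxE mulmxBr mulmxDr mulmx1 opprB addrC subrK.
have two : (2 : K) != 0 by rewrite pnatr_eq0.
apply: (mulfI two); rewrite [LHS]mulr_natl mulr2n -trV e trVS subr0 trVP.
rewrite mxtrace_diag -[LHS]mulr2n -[LHS]mulr_natl; congr (_ * _).
rewrite mulr_sumr raddf_sum; apply: eq_bigr => i _.
by rewrite mxE /=; congr (sreal K _); ring.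
Qed.

End Basis.

Lemma moment_angles k : is_principal_angles E F theta ->
  moment Phi S T k = (\sum_(i < n) cos (k%:R * (2 * theta`_i))) / n%:R.
Proof.
move=> [_ _ _ [e [f [oe of_ ef]]]].
have [pE gA] := orthonormal_rows oe; have [pF _] := orthonormal_rows of_.
rewrite /moment (word_tr_angles pE pF gA) ?(re_real Phi).
  by rewrite natrM -mulf_div divff ?mul1r.
apply/matrixP => i j; rewrite !mxE.
pose i' := cast_ord (esym (gdim E)) i; pose j' := cast_ord (esym (gdim F)) j.
have -> : sreal K (cos theta`_i) *+ (i == j) =
    if i == j :> nat then sreal K (cos theta`_i) else 0.
  by rewrite -val_eqE /=; case: eqP.
rewrite -(ef i' j'); apply: eq_bigr => l _.
by rewrite !mxE !(tnth_nth 0).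
Qed.

End PrincipalAngles.

(** * Density of trigonometric polynomials *)

Section TrigonometricPolynomials.
Context (R : realType).
Implicit Types (f g h : R -> R) (x t u : R).

(** Cosines of even multiples of [x] suffice: they are the polynomials in
    [cos x ^+ 2], a coordinate on [[0, pi / 2]]. *)
Definition is_trig_poly h := exists N (c : nat -> R),
  forall x, h x = \sum_(k < N) c k * cos (k%:R * (2 * x)).

Lemma trig_polyD f g : is_trig_poly f -> is_trig_poly g ->
  is_trig_poly (fun x => f x + g x).
Proof.
move=> [N [c hc]] [M [e he]].
have pad (L L' : nat) (b : nat -> R) y : (L <= L')%N ->
    \sum_(k < L) b k * cos (k%:R * (2 * y)) =
    \sum_(k < L') (if (k < L)%N then b k else 0) * cos (k%:R * (2 * y)).
  move=> LL; rewrite (big_ord_widen _ (fun k => b k * cos (k%:R * (2 * y))) LL).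
  by rewrite big_mkcond; apply: eq_bigr => k _; case: ifP => // _; rewrite mul0r.
exists (maxn N M), (fun k => (if (k < N)%N then c k else 0) + (if (k < M)%N then e k else 0)).
move=> x; rewrite hc he (pad _ _ c x (leq_maxl N M)) (pad _ _ e x (leq_maxr N M)).
by rewrite -big_split; apply: eq_bigr => k _; rewrite [RHS]mulrDl.
Qed.

Lemma trig_polyZ a f : is_trig_poly f -> is_trig_poly (fun x => a * f x).
Proof.
move=> [N [c hc]]; exists N, (fun k => a * c k) => x.
by rewrite hc mulr_sumr; apply: eq_bigr => k _; rewrite mulrA.
Qed.

Lemma trig_poly_cos k : is_trig_poly (fun x => cos (k%:R * (2 * x))).
Proof.
exists k.+1, (fun j => (j == k)%:R) => x.
rewrite big_ord_recr /= eqxx mul1r big1 ?add0r // => j _.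
by rewrite ltn_eqF ?ltn_ord // mul0r.
Qed.

Lemma trig_poly_cst a : is_trig_poly (fun=> a).
Proof.
have := trig_polyZ a (trig_poly_cos 0); congr is_trig_poly.
by apply/funext => x; rewrite mul0r cos0 mulr1.
Qed.

Lemma trig_poly_sum N (F : nat -> R -> R) : (forall k, is_trig_poly (F k)) ->
  is_trig_poly (fun x => \sum_(k < N) F k x).
Proof.
move=> h; elim: N => [|N ih].
  have := trig_poly_cst 0; congr is_trig_poly.
  by apply/funext => x; rewrite big_ord0.
have := trig_polyD ih (h N); congr is_trig_poly.
by apply/funext => x; rewrite big_ord_recr.
Qed.

Lemma trig_polyM_cos f : is_trig_poly f -> is_trig_poly (fun x => cos (2 * x) * f x).
Proof.
move=> [N [c hc]].
have h k : is_trig_poly (fun x => cos (2 * x) * (c k * cos (k%:R * (2 * x)))).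
  case: k => [|k].
    have := trig_polyZ (c 0%N) (trig_poly_cos 1); congr is_trig_poly.
    by apply/funext => x; rewrite mul0r cos0 mul1r mulr1 mulrC.
  have := trig_polyZ (c k.+1 / 2) (trig_polyD (trig_poly_cos k.+2) (trig_poly_cos k)).
  congr is_trig_poly; apply/funext => x; set y := 2 * x.
  have -> : k.+2%:R * y = k.+1%:R * y + y by rewrite -[k.+2]addn1 natrD mulrDl mul1r.
  have -> : k%:R * y = k.+1%:R * y - y by rewrite -[k.+1]addn1 natrD mulrDl mul1r addrK.
  by rewrite cosB cosD; field.
have := trig_poly_sum N h; congr is_trig_poly.
by apply/funext => x; rewrite hc mulr_sumr.
Qed.

Lemma sqr_cosE x : cos x ^+ 2 = (1 + cos (2 * x)) / 2.
Proof. by rewrite mulr_natl cosD -[sin x * sin x]expr2 sin2cos2; field. Qed.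

Lemma trig_polyM_sqr_cos f : is_trig_poly f -> is_trig_poly (fun x => cos x ^+ 2 * f x).
Proof.
move=> hf; have := trig_polyZ (2^-1) (trig_polyD hf (trig_polyM_cos hf)).
congr is_trig_poly; apply/funext => x.
by rewrite sqr_cosE; field.
Qed.

(** The Bernstein operator: the expected value of [phi] at a binomial random
    variable of parameters [N] and [u], computed one trial at a time. *)
Fixpoint bernstein N (phi : nat -> R) u : R :=
  if N is N'.+1 then
    u * bernstein N' (phi \o S) u + (1 - u) * bernstein N' phi u
  else phi 0%N.

Lemma bernstein_trig_poly N phi : is_trig_poly (fun x => bernstein N phi (cos x ^+ 2)).
Proof.
elim: N phi => [|N ih] phi /=; first exact: trig_poly_cst.
apply: trig_polyD; first exact: trig_polyM_sqr_cos.
have := trig_polyD (ih phi) (trig_polyZ (-1) (trig_polyM_sqr_cos (ih phi))).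
by congr is_trig_poly; apply/funext => x; ring.
Qed.

Lemma bernsteinD N phi psi u :
  bernstein N (fun k => phi k + psi k) u = bernstein N phi u + bernstein N psi u.
Proof.
elim: N phi psi => [//|N ih] phi psi /=.
by rewrite (ih phi psi) (ih (phi \o S) (psi \o S)); ring.
Qed.

Lemma bernsteinZ N a phi u :
  bernstein N (fun k => a * phi k) u = a * bernstein N phi u.
Proof.
elim: N phi => [//|N ih] phi /=.
by rewrite (ih phi) (ih (phi \o S)); ring.
Qed.

Lemma bernstein_cst N a u : bernstein N (fun=> a) u = a.
Proof. by elim: N => [//|N ih] /=; rewrite [_ \o S](_ : _ = fun=> a) // ih; ring. Qed.

Lemma le_bernstein N phi psi u : 0 <= u <= 1 -> (forall k, (k <= N)%N -> phi k <= psi k) ->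
  bernstein N phi u <= bernstein N psi u.
Proof.
move=> /andP[u0 u1]; elim: N phi psi => [|N ih] phi psi h /=; first exact: h.
apply: lerD; apply: ler_wpM2l; rewrite ?subr_ge0 //.
  by apply: ih => k kN; exact: h.
by apply: ih => k kN; apply: h; exact: leqW.
Qed.

(** The second moment about [a] of a binomial variable: variance plus squared
    bias. *)
Lemma bernstein_variance N a u :
  bernstein N (fun k => (k%:R - a) ^+ 2) u = N%:R * u * (1 - u) + (N%:R * u - a) ^+ 2.
Proof.
elim: N a => [|N ih] a /=; first by ring.
have -> : (fun k => (k%:R - a) ^+ 2) \o S = (fun k => (k%:R - (a - 1)) ^+ 2).
  by apply/funext => k /=; rewrite -natr1; congr (_ ^+ 2); ring.
by rewrite !ih -natr1; ring.
Qed.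

Lemma unif_continuous_segment f (a b e : R) : continuous f -> 0 < e ->
  exists2 d : R, 0 < d & forall x y, x \in `[a, b] ->
    `|x - y| < d -> `|f x - f y| <= e.
Proof.
move=> cf e0.
have /compact_near_coveringP cK := @segment_compact R a b.
have H : forall x0 : R, `[a, b]%classic x0 -> \forall x \near x0 & d \near (0^'+),
    forall y : R, `|x - y| < d -> `|f x - f y| <= e.
  move=> x0 _; have e2 : 0 < e / 2 by rewrite divr_gt0.
  have /cvgrPdist_le/(_ _ e2)/nbhs_ballP[d /= d0 hd] := cf x0.
  have d2 : 0 < d / 2 by rewrite divr_gt0.
  exists (ball x0 (d / 2), [set t | t < d / 2]) => /=.
    by split; [exact: nbhsx_ballx|exact: nbhs_right_lt].
  move=> [x t] /= [xb td] y xy.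
  have xb' : `|x0 - x| < d / 2 by exact: xb.
  have h1 : `|f x0 - f x| <= e / 2 by apply: hd; rewrite /ball /=; lra.
  have h2 : `|f x0 - f y| <= e / 2.
    apply: hd; rewrite /ball /=.
    have := ler_normD (x0 - x) (x - y); rewrite subrKA; lra.
  have := ler_normB (f x0 - f y) (f x0 - f x).
  have -> : f x0 - f y - (f x0 - f x) = f x - f y by ring.
  lra.
have {}H := cK R (0^'+) (fun d x => forall y, `|x - y| < d -> `|f x - f y| <= e)
  (at_right_proper_filter 0) H.
near (0 : R)^'+ => d; exists d; first by near: d; exact: nbhs_right_gt.
move=> x y xab; have hd : `[a, b]%classic `<=`
    (fun z => forall y, `|z - y| < d -> `|f z - f y| <= e) by near: d; exact: H.
exact: hd.
Unshelve. all: by end_near. Qed.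

(** The difference of the squared cosines is [sin (x + t) * sin (x - t)], and
    [sin (x + t) - sin (x - t) = 2 cos x sin t]. *)
Lemma sqr_cos_separates x t : 0 <= t -> t <= x -> x <= pi / 2 ->
  sin (x - t) ^+ 2 <= cos t ^+ 2 - cos x ^+ 2.
Proof.
move=> t0 tx xp.
have p0 := pi_gt0 R.
have E : cos t ^+ 2 - cos x ^+ 2 = sin (x + t) * sin (x - t).
  rewrite sinD sinB.
  have sx := sin2cos2 x; have st := sin2cos2 t.
  have -> : (sin x * cos t + cos x * sin t) * (sin x * cos t - cos x * sin t) =
     sin x ^+ 2 * cos t ^+ 2 - cos x ^+ 2 * sin t ^+ 2 by ring.
  by rewrite sx st; ring.
have s0 : 0 <= sin (x - t) by apply: sin_ge0_pi; lra.
rewrite E expr2 ler_wpM2r // -subr_ge0.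
have -> : sin (x + t) - sin (x - t) = cos x * sin t + cos x * sin t.
  by rewrite sinD sinB; ring.
have cx : 0 <= cos x by apply: cos_ge0_pihalf; lra.
have st : 0 <= sin t by apply: sin_ge0_pi; lra.
by rewrite addr_ge0 // mulr_ge0.
Qed.

(** This serves as the uniform continuity, up to the endpoints, of the inverse of
    the squared cosine on [[0, pi / 2]]. *)
Lemma sqr_cos_close (d : R) : 0 < d -> exists2 e, 0 < e &
  forall x t, 0 <= x <= pi / 2 -> 0 <= t <= pi / 2 ->
    d <= `|x - t| -> e <= (cos x ^+ 2 - cos t ^+ 2) ^+ 2.
Proof.
move=> d0; have p0 := pi_gt0 R.
pose d' := Num.min d (pi / 2).
have d'0 : 0 < d' by rewrite lt_min d0 divr_gt0.
have d'p : d' <= pi / 2 by rewrite ge_min lexx orbT.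
have s0 : 0 < sin d' by apply: sin_gt0_pi; lra.
exists ((sin d' ^+ 2) ^+ 2); first by rewrite !exprn_gt0.
have key x t : 0 <= t -> x <= pi / 2 -> d <= x - t ->
    (sin d' ^+ 2) ^+ 2 <= (cos t ^+ 2 - cos x ^+ 2) ^+ 2.
  move=> t0 xp dxt.
  have d'd : d' <= d by rewrite ge_min lexx.
  have h := sqr_cos_separates t0 (_ : t <= x) xp.
  have {}h : sin (x - t) ^+ 2 <= cos t ^+ 2 - cos x ^+ 2 by apply: h; lra.
  have s1 : sin d' <= sin (x - t).
    rewrite leNgt; apply/negP; rewrite ltr_sin ?in_itv /=; first lra.
      by apply/andP; split; lra.
    by apply/andP; split; lra.
  have h2 : sin d' ^+ 2 <= cos t ^+ 2 - cos x ^+ 2.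
    by apply: le_trans h; rewrite ler_sqr ?nnegrE //; lra.
  rewrite ler_sqr ?nnegrE ?sqr_ge0 //; exact: le_trans (sqr_ge0 _) h2.
move=> x t /andP[x0 xp] /andP[t0 tp]; have [tx|xt] := leP t x.
  by rewrite ger0_norm ?subr_ge0 // => dxt; rewrite -[leRHS]sqrrN opprB; exact: key.
by rewrite ltr0_norm ?subr_lt0 // opprB => dxt; exact: key.
Qed.

(** Weierstrass approximation in the coordinate [u = cos x ^+ 2], by Bernstein's
    argument: [f x - f (node k)] is small if [k / N] is close to [u], and
    otherwise bounded by a multiple of [(k / N - u) ^ 2], whose binomial mean is
    at most [1 / N]. *)
Lemma trig_poly_dense f : continuous f -> bounded_fun f ->
  forall e, 0 < e -> exists2 h, is_trig_poly h &
    forall x, 0 <= x <= pi / 2 -> `|f x - h x| <= e.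
Proof.
move=> cf bf e e0; have p0 := pi_gt0 R.
have [M hM] : exists M, forall x, `|f x| <= M.
  have [M [_ hM]] := bf; exists (M + 1) => x.
  by apply: hM => //; rewrite ltrDl.
have M0 : 0 <= M by exact: le_trans (hM 0).
have e2 : 0 < e / 2 by rewrite divr_gt0.
have [d d0 hd] := unif_continuous_segment 0 (pi / 2) cf e2.
have [s s0 hs] := sqr_cos_close d0.
pose N := (Num.Def.archi_bound (4 * M / (s * e))).+1.
have N0 : 0 < N%:R :> R by rewrite ltr0n.
(* the point of [[0, pi / 2]] whose squared cosine is [k / N] *)
pose node k : R := acos (Num.sqrt (k%:R / N%:R)).
have nodeP k : (k <= N)%N -> 0 <= node k <= pi / 2 /\ cos (node k) ^+ 2 = k%:R / N%:R.
  move=> kN; set v := k%:R / N%:R.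
  have v0 : 0 <= v by rewrite divr_ge0.
  have v1 : v <= 1 by rewrite ler_pdivrMr // mul1r ler_nat.
  have sv0 : 0 <= Num.sqrt v by exact: sqrtr_ge0.
  have sv1 : Num.sqrt v <= 1 by rewrite -sqrtr1 ler_wsqrtr.
  have sI : -1 <= Num.sqrt v <= 1 by rewrite sv1 andbT; lra.
  have cE : cos (node k) = Num.sqrt v by rewrite /node acosK // in_itv.
  rewrite cE sqr_sqrtr //; split => //; rewrite acos_ge0 //=.
  rewrite leNgt; apply/negP => lt.
  have kI : node k \in `[0, pi] by rewrite in_itv /= acos_ge0 //= acos_lepi.
  have pI : (pi / 2 : R) \in `[0, pi] by rewrite in_itv /=; apply/andP; split; lra.
  have : cos (node k) < cos (pi / 2) by rewrite ltr_cos.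
  by rewrite cos_pihalf cE; lra.
pose phi k := f (node k).
exists (fun x => bernstein N phi (cos x ^+ 2)); first exact: bernstein_trig_poly.
move=> x xI; set u := cos x ^+ 2.
have u01 : 0 <= u <= 1.
  by rewrite sqr_ge0 /= /u; have := sin2cos2 x; have := sqr_ge0 (sin x); lra.
pose c := 2 * M / s.
have c0 : 0 <= c by rewrite divr_ge0 ?mulr_ge0 // ltW.
have pt k : (k <= N)%N ->
    `|f x - phi k| <= e / 2 + c / N%:R ^+ 2 * (k%:R - N%:R * u) ^+ 2.
  move=> kN; have [nI nE] := nodeP k kN.
  have -> : c / N%:R ^+ 2 * (k%:R - N%:R * u) ^+ 2 = c * (cos x ^+ 2 - cos (node k) ^+ 2) ^+ 2.
    by rewrite nE /u; field; rewrite gt_eqF.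
  have [xd|dx] := ltP `|x - node k| d.
    apply: (le_trans (hd x (node k) _ xd)); first by rewrite in_itv.
    by rewrite lerDl mulr_ge0 ?sqr_ge0.
  have h := hs x (node k) xI nI dx.
  apply: (le_trans (ler_normB _ _)).
  have h1 := hM x; have h2 := hM (node k).
  have h3 : 2 * M <= c * (cos x ^+ 2 - cos (node k) ^+ 2) ^+ 2.
    apply: (le_trans _ (ler_wpM2l c0 h)).
    by rewrite /c divfK // gt_eqF.
  by rewrite /phi; lra.
pose b k : R := e / 2 + c / N%:R ^+ 2 * (k%:R - N%:R * u) ^+ 2.
have Eb : bernstein N b u <= e.
  rewrite /b bernsteinD bernstein_cst bernsteinZ bernstein_variance subrr expr0n addr0.
  have uu : u * (1 - u) <= 1 by have /andP[] := u01; nra.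
  have : c / N%:R ^+ 2 * (N%:R * u * (1 - u)) <= e / 2.
    have -> : c / N%:R ^+ 2 * (N%:R * u * (1 - u)) = c * (u * (1 - u)) / N%:R.
      by field; rewrite gt_eqF.
    rewrite ler_pdivrMr //; apply: (le_trans (ler_piMr c0 uu)).
    have hN : 4 * M / (s * e) <= N%:R.
      apply: ltW; apply: (lt_le_trans (archi_boundP _)).
        by rewrite divr_ge0 ?mulr_ge0 // ltW.
      by rewrite ler_nat.
    move: hN; rewrite ler_pdivrMr ?mulr_gt0 // /c => hN.
    by rewrite ler_pdivrMr //; nra.
  lra.
have Ex (a : R) : bernstein N (fun k => a + (-1) * phi k) u = a - bernstein N phi u.
  by rewrite bernsteinD bernstein_cst bernsteinZ mulN1r.
have Ey (a : R) : bernstein N (fun k => (-1) * a + phi k) u = bernstein N phi u - a.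
  by rewrite bernsteinD bernstein_cst mulN1r addrC.
rewrite ler_norml; apply/andP; split.
  rewrite lerNl opprB -(Ey (f x)); apply: le_trans Eb; apply: le_bernstein => // k kN.
  by apply: le_trans (pt k kN); have := ler_norm (- (f x - phi k)); rewrite normrN; lra.
rewrite -(Ex (f x)); apply: le_trans Eb; apply: le_bernstein => // k kN.
by apply: le_trans (pt k kN); have := ler_norm (f x - phi k); lra.
Qed.

End TrigonometricPolynomials.

(** * Empirical and uniform measures on the line *)

Section LineMeasures.
Context (R : realType).
Implicit Types (f g h : R -> R).
Local Notation U := (uniform_prob (@pihalf_gt0 R)).

Lemma empirical_integral_ge0 n (x : n.-tuple R) g :
  measurable_fun setT g -> (forall y, 0 <= g y) ->
  (\int[empirical_measure x]_y (g y)%:E = ((\sum_(i < n) g x`_i) / n%:R)%:E)%E.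
Proof.
move=> mg g0; have mEg : measurable_fun setT (EFin \o (g : measurableTypeR R -> R)).
  exact/measurable_EFinP.
rewrite /empirical_measure ge0_integral_mscale //=; last by move=> y _; rewrite lee_fin.
rewrite ge0_integral_measure_sum //; last by move=> y _; rewrite lee_fin.
rewrite (eq_bigr (fun i : 'I_n => (g x`_i)%:E)); last first.
  by move=> i _ /=; rewrite integral_dirac // diracT mul1e.
by rewrite sumEFin -EFinM mulrC.
Qed.

(** The signed case, by positive and negative parts. *)
Lemma empirical_integral n (x : n.-tuple R) f : continuous f ->
  \int[empirical_measure x]_y f y = (\sum_(i < n) f x`_i) / n%:R.
Proof.
move=> cf; have mf : measurable_fun setT f := continuous_measurable_fun cf.
rewrite /Rintegral integralE.
pose p y := Num.max (f y) 0; pose q y := Num.max (- f y) 0.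
have mp : measurable_fun setT p.
  by apply: measurable_maxr => //; exact: measurable_cst.
have mq : measurable_fun setT q.
  by apply: measurable_maxr; [exact: measurable_funN|exact: measurable_cst].
have -> : ((fun y => (f y)%:E)^\+ = (fun y => (p y)%:E))%E.
  by apply/funext => y; rewrite funeposE /p EFin_max.
have -> : ((fun y => (f y)%:E)^\- = (fun y => (q y)%:E))%E.
  by apply/funext => y; rewrite funenegE /q EFin_max.
rewrite !empirical_integral_ge0 //.
- rewrite -EFinB /= -mulrBl -sumrB; congr (_ / _); apply: eq_bigr => i _.
  by rewrite /p /q; have [h|h] := leP (f x`_i) 0; have [h'|h'] := leP (- f x`_i) 0; lra.
- by move=> y; rewrite le_max lexx orbT.
- by move=> y; rewrite le_max lexx orbT.
Qed.

Lemma uniform_le_dist f g (e : R) : bounded_measurable (f : measurableTypeR R -> R) ->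
  bounded_measurable (g : measurableTypeR R -> R) ->
  (forall x, 0 <= x <= pi / 2 -> `|f x - g x| <= e) ->
  `|\int[U]_x f x - \int[U]_x g x| <= e.
Proof.
move=> bf bg h; have e0 : 0 <= e.
  by apply: le_trans (h 0 _) => //; rewrite lexx /= ltW // pihalf_gt0.
have b1 : bounded_measurable (fun x : measurableTypeR R => (-1) * g x).
  exact: bounded_measurableZ.
have b2 := bounded_measurableD bf b1.
have -> : \int[U]_x f x - \int[U]_x g x = \int[U]_x (f x + (-1) * g x).
  by rewrite expectD // expectZ // mulN1r.
apply: (le_trans (le_normr_Rintegral _ _)) => //.
  exact: bounded_measurable_integrable.
have [mb _] := bounded_measurable_norm b2.
have mEb : measurable_fun setT (fun x : measurableTypeR R => (`|f x + (-1) * g x|)%:E).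
  exact/measurable_EFinP.
have mc : measurable_fun setT (fun x : measurableTypeR R => e%:E) by exact: measurable_cst.
rewrite -lee_fin /Rintegral fineK; last first.
  exact: (integrable_fin_num measurableT (bounded_measurable_integrable U (bounded_measurable_norm b2))).
have -> : e%:E = (\int[U]_(x in setT) e%:E)%E.
  by rewrite integral_cst //= (@probability_setT _ _ _ U) mule1.
rewrite (integral_uniform _ mc) ?(integral_uniform _ mEb) //.
rewrite lee_pmul2l //; last first.
  by rewrite lte_fin invr_gt0 subr0 pihalf_gt0.
apply: ge0_le_integral => //; first exact: (measurable_funS measurableT _ mEb).
move=> x; rewrite /= in_itv /= => xI; rewrite lee_fin mulN1r; exact: h.
Qed.

Lemma bounded_measurable_cos (a : R) :
  bounded_measurable (fun x : measurableTypeR R => cos (a * x)).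
Proof.
split; last by exists 1 => x; rewrite ler_norml cos_geN1 cos_le1.
apply: continuous_measurable_fun => x.
apply: (@continuous_comp _ _ _ (fun x => a * x) (@cos R)); last exact: continuous_cos.
exact: mulrl_continuous.
Qed.

Lemma uniform_cos k : (0 < k)%N -> \int[U]_x cos (k%:R * (2 * x)) = 0.
Proof.
move=> k0; pose a : R := k%:R * 2.
have a0 : 0 < a by rewrite mulr_gt0 // ltr0n.
have E : (fun x : R => cos (k%:R * (2 * x))) = (fun x => cos (a * x)).
  by apply/funext => x; rewrite /a mulrA.
rewrite E.
have bc := bounded_measurable_cos a.
have b1 := bounded_measurable_cst (measurableTypeR R) (1 : R).
(* adding [1] makes the integrand nonnegative, as [integral_uniform] requires *)
suff : \int[U]_x (1 + cos (a * x)) = 1.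
  by rewrite expectD // expect_cst => /eqP; rewrite -subr_eq0 addrC addrA addNr add0r => /eqP.
have [m1 _] := bounded_measurableD b1 bc.
have mE1 : measurable_fun setT (fun x : measurableTypeR R => (1 + cos (a * x))%:E).
  exact/measurable_EFinP.
have E1 : (forall x : measurableTypeR R, 0 <= (1 + cos (a * x))%:E)%E.
  by move=> x; rewrite lee_fin; have := cos_geN1 (a * x); lra.
rewrite /Rintegral (integral_uniform _ mE1 E1).
pose F x : R := x + sin (a * x) / a.
have dF x : is_derive x (1 : R) F (1 + cos (a * x)).
  have da : is_derive x (1 : R) (fun x : R => a * x) a.
    by apply: is_derive_eq; rewrite /GRing.scale /= mulr1.
  have ds : is_derive x (1 : R) (fun x : R => sin (a * x)) (cos (a * x) * a).
    exact: (is_derive1_comp (f := @sin R)).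
  rewrite /F.
  apply: is_derive_eq.
  by rewrite /GRing.scale /= mulr0; field; rewrite gt_eqF.
have cF : continuous F.
  move=> x; apply: differentiable_continuous; apply/derivable1_diffP.
  by have [] := dF x.
rewrite (@continuous_FTC2 _ _ F) ?pihalf_gt0 //.
- rewrite /F mulr0 sin0 mul0r addr0 subr0.
  have -> : sin (a * (pi / 2)) = 0.
    have -> : a * (pi / 2) = pi *+ k by rewrite /a -mulr_natl; field.
    by elim: (k) => [|j ih]; rewrite ?mulr0n ?sin0 // mulrSr sinDpi ih oppr0.
  by rewrite mul0r addr0 sube0 -EFinM mulVf //= gt_eqF // pihalf_gt0.
- apply: continuous_subspaceT => x; apply: cvgD; first exact: cvg_cst.
  apply: (@continuous_comp _ _ _ (fun x => a * x) (@cos R)); last exact: continuous_cos.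
  exact: mulrl_continuous.
- split; last 2 first.
  + exact/cvg_at_right_filter/cF.
  + exact/cvg_at_left_filter/cF.
  by move=> x _; have [] := dF x.
by move=> x _; rewrite derive1E; have [] := dF x.
Qed.

Lemma trig_sum_bounded_measurable N (c : nat -> R) :
  bounded_measurable (fun x : measurableTypeR R => \sum_(k < N) c k * cos (k%:R * (2 * x))).
Proof.
apply: bounded_measurable_sum => k; apply: bounded_measurableZ.
have := bounded_measurable_cos (k%:R * 2); congr bounded_measurable.
by apply/funext => x; rewrite mulrA.
Qed.

Lemma uniform_trig_sum N (c : nat -> R) :
  \int[U]_x (\sum_(k < N.+1) c k * cos (k%:R * (2 * x))) = c 0%N.
Proof.
have bk (k : 'I_N.+1) : bounded_measurable
    (fun x : measurableTypeR R => cos (k%:R * (2 * x))).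
  have := bounded_measurable_cos (k%:R * 2); congr bounded_measurable.
  by apply/funext => x; rewrite mulrA.
rewrite expect_sum; last by move=> k; exact: bounded_measurableZ.
rewrite big_ord_recl big1 => [|k _]; last by rewrite expectZ // uniform_cos // mulr0.
rewrite addr0 expectZ //.
have -> : (fun x : R => cos ((@ord0 N : 'I_N.+1)%:R * (2 * x))) = (fun=> 1).
  by apply/funext => x; rewrite mul0r cos0.
by rewrite expect_cst mulr1.
Qed.

End LineMeasures.

(** * Convergence in probability *)

(** The joint law of independent variables is a product measure, so that
    integration over one variable may be performed with the other one frozen. *)
Lemma independent_integral (R : realType) (d d1 d2 : measure_display)
    (T : measurableType d) (T1 : measurableType d1) (T2 : measurableType d2)
    (P : probability T R) (X : {RV P >-> T1}) (Y : {RV P >-> T2})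
    (f : T1 * T2 -> \bar R) :
  independent_RV X Y -> measurable_fun setT f -> (forall z, 0 <= f z)%E ->
  (\int[P]_w f (X w, Y w) =
   \int[distribution P X]_x \int[distribution P Y]_y f (x, y))%E.
Proof.
move=> XY mf f0; pose Z w := (X w, Y w).
have mZ : measurable_fun setT Z by exact: measurable_fun_pair.
have <- : (\int[pushforward P Z]_z f z = \int[P]_w f (X w, Y w))%E.
  by rewrite ge0_integral_pushforward // => z _; exact: f0.
rewrite -(@fubini_tonelli1 _ _ _ _ _ (distribution P X) (distribution P Y) f mf f0).
apply: eq_measure_integral => A mA _; symmetry.
by apply: product_measure_unique => // B C mB mC; exact: XY.
Qed.

Section RandomPair.
Context (R : realType) (K : scalarField R) (Phi : scalar_parts K) (n : nat).
Local Notation G := (grassmann K (leq_mul2n n)).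
Context (d : measure_display) (T : measurableType d) (P : probability T R).
Variables (E F : {RV P >-> G}).

Definition pair_moment k (w : T) : R :=
  moment Phi (greflection (E w)) (greflection (F w)) k.

Let joint_moment k (z : G * G) : R :=
  moment Phi (greflection z.1) (greflection z.2) k.

Let joint_moment_measurable k : measurable_fun setT (joint_moment k).
Proof.
rewrite /joint_moment /moment; apply: measurable_funM; last exact: measurable_cst.
have m1 : mx_measurable Phi (fun z : G * G => greflection z.1).
  by apply: (mx_measurable_comp measurable_fst); exact: greflection_measurable.
have m2 : mx_measurable Phi (fun z : G * G => greflection z.2).
  by apply: (mx_measurable_comp measurable_snd); exact: greflection_measurable.
have m3 := mx_measurable_mul m2 m1.
by have [] := kmeasurable_tr (mx_measurableX k m3).
Qed.

Lemma pair_moment_bounded_measurable k : bounded_measurable (pair_moment k).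
Proof.
split.
  have mZ : measurable_fun setT (fun w => (E w, F w)) by exact: measurable_fun_pair.
  exact: (measurableT_comp (joint_moment_measurable k) mZ).
by exists 1 => w; apply: moment_le1; exact: (greflection_symmetry Phi).
Qed.

(** A mean bound that is uniform in the frozen reflection [S] survives averaging
    over an independent subspace. *)
Lemma expect_pair_moment_le k (e : R) : independent_RV E F ->
  (forall S : 'M[K]_(2 * n), balanced_symmetry S ->
    \int[distribution P F]_V (moment Phi S (greflection V) k ^+ 2) <= e) ->
  \int[P]_w (pair_moment k w ^+ 2) <= e.
Proof.
move=> EF h.
have b2 : bounded_measurable (fun w => pair_moment k w ^+ 2).
  by under eq_fun do rewrite expr2; apply: bounded_measurableM; exact: pair_moment_bounded_measurable.
rewrite -lee_fin /Rintegral fineK; last first.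
  exact: (integrable_fin_num measurableT (bounded_measurable_integrable P b2)).
have mf : measurable_fun setT (fun z : G * G => (joint_moment k z ^+ 2)%:E).
  by apply/measurable_EFinP; exact: measurable_funX.
rewrite (independent_integral EF mf); last by move=> z; rewrite lee_fin sqr_ge0.
have <- : (\int[distribution P E]_(x in setT) e%:E = e%:E)%E.
  by rewrite integral_cst //= (@probability_setT _ _ _ (distribution P E)) mule1.
apply: ge0_le_integral => //.
- by move=> x _; apply: integral_ge0 => y _; rewrite lee_fin sqr_ge0.
- apply: (@measurable_fun_fubini_tonelli_F _ _ _ _ _ (distribution P F) _ mf).
  by move=> z; rewrite lee_fin sqr_ge0.
move=> V _; have hV := greflection_symmetry Phi V.
have bV : bounded_measurable (fun V' : G => moment Phi (greflection V) (greflection V') k ^+ 2).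
  by under eq_fun do rewrite expr2; apply: bounded_measurableM; exact: moment_bounded_measurable.
have := h _ hV; rewrite -lee_fin /Rintegral fineK //.
exact: (integrable_fin_num measurableT (bounded_measurable_integrable _ bV)).
Qed.

Section Angles.
Variable theta : T -> n.-tuple R.
Hypothesis htheta : forall w, is_principal_angles (E w) (F w) (theta w).

Definition angle_mean (f : R -> R) w : R := (\sum_(i < n) f (theta w)`_i) / n%:R.

Lemma angle_mean_trig N (c : nat -> R) w :
  angle_mean (fun x => \sum_(k < N) c k * cos (k%:R * (2 * x))) w =
  \sum_(k < N) c k * pair_moment k w.
Proof.
rewrite /angle_mean exchange_big /= mulr_suml; apply: eq_bigr => k _.
by rewrite -mulr_sumr -mulrA /pair_moment (moment_angles Phi k (htheta w)).
Qed.

Lemma angle_mean_le_dist f g (e : R) w : 0 <= e ->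
  (forall x, 0 <= x <= pi / 2 -> `|f x - g x| <= e) ->
  `|angle_mean f w - angle_mean g w| <= e.
Proof.
move=> e0 h; rewrite /angle_mean -mulrBl -sumrB normrM normfV normr_nat.
have [n0|n0] := posnP n.
  by rewrite [X in X%:R^-1]n0 invr0 mulr0.
rewrite ler_pdivrMr ?ltr0n // mulr_natr -[X in _ *+ X]card_ord -sumr_const.
apply: (le_trans (ler_norm_sum _ _ _)); apply: ler_sum => i _; apply: h.
have [sz _ ht _] := htheta w; apply: ht; apply: mem_nth.
by rewrite size_tuple.
Qed.

(** The angles need not depend measurably on the sample point, but means of
    trigonometric polynomials over them are combinations of traces, and the mean
    of [f] is a limit of such means. *)
Lemma angle_mean_measurable f : continuous f -> bounded_fun f ->
  measurable_fun setT (angle_mean f).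
Proof.
move=> cf bf.
have /boolp.choice[h hh] : forall j : nat, exists h, is_trig_poly h /\
    forall x, 0 <= x <= pi / 2 -> `|f x - h x| <= j.+1%:R^-1.
  move=> j; have j0 : 0 < j.+1%:R^-1 :> R by rewrite invr_gt0.
  by have [h th hh] := trig_poly_dense cf bf j0; exists h.
apply: (@measurable_fun_cvg _ _ _ _ (fun j => angle_mean (h j))).
  move=> j; have [[N [c hc]] _] := hh j.
  have -> : angle_mean (h j) = (fun w => \sum_(k < N) c k * pair_moment k w).
    by apply/funext => w; rewrite -angle_mean_trig /angle_mean; congr (_ / _); apply: eq_bigr => i _; rewrite hc.
  have [] : bounded_measurable (fun w => \sum_(k < N) c k * pair_moment k w).
    apply: bounded_measurable_sum => k; apply: bounded_measurableZ.
    exact: pair_moment_bounded_measurable.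
  by [].
move=> w _; apply/cvgrPdist_le => e e0.
near=> j; have [_ hj] := hh j.
apply: (@le_trans _ _ (j.+1%:R^-1)); first by apply: angle_mean_le_dist.
by apply: ltW; near: j; exact: (near_infty_natSinv_lt (PosNum e0)).
Unshelve. all: by end_near. Qed.

(** From [`|x| <= dl + x ^+ 2 / dl], which trades the moments for their squares at
    the price of a constant that is chosen small. *)
Lemma tail_sum_le N (c : nat -> R) (dl : R) w : 0 < dl ->
  `|\sum_(1 <= k < N) c k * pair_moment k w| <=
  dl * (\sum_(1 <= k < N) `|c k|)
    + \sum_(1 <= k < N) `|c k| / dl * pair_moment k w ^+ 2.
Proof.
move=> dl0; apply: (le_trans (ler_norm_sum _ _ _)).
rewrite mulr_sumr -big_split /=; apply: ler_sum => k _.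
rewrite normrM; have := normr_ge0 (c k); set a := `|c k|; set x := pair_moment k w => a0.
have -> : dl * a + a / dl * x ^+ 2 = a * (dl + x ^+ 2 / dl) by field; rewrite gt_eqF.
rewrite ler_wpM2l // -(ler_pM2l dl0) mulrDr mulrCA divff ?gt_eqF // mulr1.
rewrite -(real_normK (num_real x)).
by have := sqr_ge0 (`|x| - dl); have := normr_ge0 x; nra.
Qed.

End Angles.
End RandomPair.

(** Replace [f] by a trigonometric polynomial [h] up to [eps / 4]. Its constant
    term is both its mean over [[0, pi / 2]] and the contribution of the moment
    of order [0]. So a deviation of [eps] forces the other moments to be large,
    and Markov's inequality applies. *)
Lemma angles_cvg_in_probability (R : realType) (K : scalarField R)
    (Phi : scalar_parts K)
    (d : nat -> measure_display) (T : forall n, measurableType (d n))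
    (P : forall n, probability (T n) R)
    (E F : forall n, {RV (P n) >-> grassmann K (leq_mul2n n)})
    (hF : forall n, is_haar (distribution (P n) (F n)))
    (hEF : forall n, independent_RV (E n) (F n))
    (theta : forall n, T n -> n.-tuple R)
    (htheta : forall n w, is_principal_angles (E n w) (F n w) (theta n w)) :
  weak_cvg_in_probability P
    (fun n w => empirical_measure (theta n w))
    (uniform_prob (@pihalf_gt0 R)).
Proof.
move=> f cf bf eps eps0.
set I := \int[uniform_prob (@pihalf_gt0 R)]_x f x.
have e4 : 0 < eps / 4 by rewrite divr_gt0.
have [h [N0 [c hc]] fh] := trig_poly_dense cf bf e4.
pose c' k : R := if (k < N0)%N then c k else 0.
(* pad the sum so that the constant term [c' 0] always exists *)
have {}hc x : h x = \sum_(k < N0.+1) c' k * cos (k%:R * (2 * x)).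
  rewrite hc big_ord_recr /= /c' ltnn mul0r addr0.
  by apply: eq_bigr => k _; rewrite ltn_ord.
have hE : h = (fun x => \sum_(k < N0.+1) c' k * cos (k%:R * (2 * x))) by apply/funext.
have bmf : bounded_measurable (f : measurableTypeR R -> R).
  split; first exact: continuous_measurable_fun.
  have [M [_ hM]] := bf; exists (M + 1) => x.
  by apply: hM => //; rewrite ltrDl.
have bmh : bounded_measurable (h : measurableTypeR R -> R).
  rewrite hE; exact: trig_sum_bounded_measurable.
have If : `|I - c' 0%N| <= eps / 4.
  rewrite -[c' 0%N](uniform_trig_sum N0) -hE.
  exact: uniform_le_dist.
pose A n := [set w | eps < `|\int[empirical_measure (theta n w)]_x f x - I|].
have AE n : A n = [set w | eps < `|angle_mean (theta n) f w - I|].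
  by apply/seteqP; split => w; rewrite /A /= empirical_integral.
have mA n : measurable (A n).
  rewrite AE; have mm := angle_mean_measurable Phi (@htheta n) cf bf.
  have mg : measurable_fun setT (fun w => `|angle_mean (theta n) f w - I|).
    apply: measurableT_comp => //; apply: measurable_funB => //; exact: measurable_cst.
  rewrite -[X in measurable X]setTI.
  have := mg measurableT _ (measurable_itv `]eps, +oo[).
  congr measurable; congr (_ `&` _); apply/seteqP; split => w /=.
    by rewrite in_itv /= andbT.
  by rewrite in_itv /= andbT.
pose M n k := pair_moment Phi (E n) (F n) k.
have sub n w : (0 < n)%N -> A n w -> eps / 2 <= `|\sum_(1 <= k < N0.+1) c' k * M n k w|.
  move=> n0; rewrite AE /= => Aw.
  have h1 := angle_mean_le_dist (@htheta n) w (ltW e4) fh.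
  have h2 : angle_mean (theta n) h w = c' 0%N + \sum_(1 <= k < N0.+1) c' k * M n k w.
    rewrite hE (angle_mean_trig Phi (@htheta n)).
    rewrite -(big_mkord xpredT (fun k => c' k * M n k w)) big_ltn //; congr (_ + _).
    by rewrite /M /pair_moment moment0 ?mulr1 // muln_gt0.
  move: h1; rewrite h2; set s := \sum_(1 <= k < _) _; set x := angle_mean _ _ _ in Aw * => h1.
  have := ler_normD (x - (c' 0%N + s)) (s + (c' 0%N - I)).
  have -> : x - (c' 0%N + s) + (s + (c' 0%N - I)) = x - I by ring.
  have := ler_normD s (c' 0%N - I); rewrite [`|c' 0%N - I|]distrC; lra.
pose p n := fine (P n (A n)).
apply: cvg_EFin.
  by apply: nearW => n; rewrite -/(A n); exact: fin_num_measure.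
change (p @ \oo --> 0).
apply/cvgrPdist_le => eta eta0.
pose C := \sum_(1 <= k < N0.+1) `|c' k|.
have C0 : 0 <= C by apply: sumr_ge0 => k _.
pose dl := eta * eps / (4 * (C + 1)).
have dl0 : 0 < dl by rewrite divr_gt0 ?mulr_gt0 //; lra.
pose B := \sum_(1 <= k < N0.+1) `|c' k| / dl.
have B0 : 0 <= B by apply: sumr_ge0 => k _; rewrite divr_ge0 // ltW.
pose b := eta * eps / (4 * (B + 1)).
have b0 : 0 < b by rewrite divr_gt0 ?mulr_gt0 //; lra.
have /boolp.choice[Nk hNk] : forall k, exists N, (0 < k)%N ->
    forall n : nat, (N <= n)%N ->
    forall (S : 'M[K]_(2 * n)) (nu : probability (grassmann K (leq_mul2n n)) R),
    balanced_symmetry S -> is_haar nu ->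
    \int[nu]_V (moment Phi S (greflection V) k ^+ 2) <= b.
  case=> [|k]; first by exists 0%N.
  by have [N hN] := moment_sqr_cvg0 Phi (ltn0Sn k) b0; exists N.
near=> n.
have n0 : (0 < n)%N by near: n; exact: nbhs_infty_gt.
have nN : (\max_(k < N0.+1) Nk k <= n)%N by near: n; exact: nbhs_infty_ge.
have p0 : 0 <= p n by rewrite fine_ge0.
rewrite sub0r normrN ger0_norm //.
have bM k : bounded_measurable (fun w => M n k w ^+ 2).
  by under eq_fun do rewrite expr2; apply: bounded_measurableM; exact: pair_moment_bounded_measurable.
have EM k : (0 < k < N0.+1)%N -> \int[P n]_w (M n k w ^+ 2) <= b.
  move=> /andP[k0 kN]; apply: expect_pair_moment_le => // S hS.
  by apply: hNk => //; exact: leq_trans (leq_bigmax (Ordinal kN)) nN.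
have bterm k : bounded_measurable (fun w => `|c' k| / dl * M n k w ^+ 2).
  exact: bounded_measurableZ.
have bsum : bounded_measurable
    (fun w => \sum_(1 <= k < N0.+1) `|c' k| / dl * M n k w ^+ 2).
  exact: bounded_measurable_sum.
have bdl := bounded_measurable_cst (T n) (dl * C).
have btot := bounded_measurableD bdl bsum.
have bind : bounded_measurable (\1_(A n) : T n -> R).
  split; first exact: measurable_indic.
  by exists 1 => w; rewrite indicE; case: (_ \in _); rewrite ?normr1 ?normr0.
have -> : p n = \int[P n]_w \1_(A n) w.
  by rewrite /Rintegral integral_indic // setIT.
have step : \int[P n]_w \1_(A n) w <= \int[P n]_w (2 / eps *
    (dl * C + \sum_(1 <= k < N0.+1) `|c' k| / dl * M n k w ^+ 2)).
  apply: le_expect => //; first exact: bounded_measurableZ.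
  move=> w; rewrite indicE; case: (boolP (w \in A n)) => [|_].
    rewrite inE => /(sub n w n0) h1.
    have h2 := le_trans h1 (tail_sum_le Phi (E n) (F n) N0.+1 c' w dl0).
    have -> : true%:R = 2 / eps * (eps / 2) :> R.
      by rewrite /= mulr1n; field; rewrite gt_eqF.
    by rewrite ler_pM2l ?divr_gt0.
  apply: mulr_ge0; first by rewrite divr_ge0 // ltW.
  apply: addr_ge0; first by rewrite mulr_ge0 // ltW.
  by apply: sumr_ge0 => k _; rewrite mulr_ge0 ?sqr_ge0 // divr_ge0 // ltW.
apply: (le_trans step); rewrite expectZ // expectD // expect_cst expect_sum //.
have s1 : \sum_(1 <= k < N0.+1) \int[P n]_w (`|c' k| / dl * M n k w ^+ 2) <= B * b.
  rewrite /B mulr_suml big_nat_cond [leRHS]big_nat_cond; apply: ler_sum => k.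
  rewrite andbT => kI; rewrite expectZ // ler_wpM2l ?EM //.
  by rewrite divr_ge0 // ltW.
have hB : B * b <= eta * eps / 4.
  rewrite /b; have -> : eta * eps / 4 = (B + 1) * (eta * eps / (4 * (B + 1))).
    by field; rewrite gt_eqF //; lra.
  by rewrite ler_wpM2r ?(ltW b0) //; lra.
have hC : dl * C <= eta * eps / 4.
  rewrite /dl; have -> : eta * eps / 4 = eta * eps / (4 * (C + 1)) * (C + 1).
    by field; rewrite gt_eqF //; lra.
  by rewrite ler_wpM2l ?(ltW dl0) //; lra.
have -> : eta = 2 / eps * (eta * eps / 4 + eta * eps / 4).
  by field; rewrite gt_eqF.
rewrite ler_wpM2l ?divr_ge0 ?(ltW eps0) //; lra.
Unshelve. all: by end_near. Qed.

Theorem corollary3 (R : realType) (K : scalarField R)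
    (hK : K = realScalars R \/ K = complexScalars R)
    (d : nat -> measure_display) (T : forall n, measurableType (d n))
    (P : forall n, probability (T n) R)
    (E F : forall n, {RV (P n) >-> grassmann K (leq_mul2n n)})
    (hE : forall n, is_haar (distribution (P n) (E n)))
    (hF : forall n, is_haar (distribution (P n) (F n)))
    (hEF : forall n, independent_RV (E n) (F n))
    (theta : forall n, T n -> n.-tuple R)
    (htheta : forall n w, is_principal_angles (E n w) (F n w) (theta n w)) :
  weak_cvg_in_probability P
    (fun n w => empirical_measure (theta n w))
    (uniform_prob (@pihalf_gt0 R)).
Proof.
case: hK => hK; subst K.
  exact: (angles_cvg_in_probability (real_parts R) hF hEF htheta).
exact: (angles_cvg_in_probability (complex_parts R) hF hEF htheta).
Qed.
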